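(* Suppose that $\mathbf V_h\subset\mathbf V$, $Q_h\subset Q$, $W_h\subset W$ are finite element spaces, and that the pair $\mathbf V_h\times Q_h$ satisfies the inf-sup condition $$\inf_{\xi\in Q_h\cap L_0^2(\Omega)}\ \sup_{\mathbf v\in\mathbf V_h}\frac{(\nabla\cdot\mathbf v,\xi)}{\|\mathbf v\|_1\|\xi\|_0}\ge\gamma>0$$ with $\gamma$ independent of the mesh size $h$. Let $X_h=\mathbf V_h\times Q_h\times W_h\times W_h$ be the Hilbert space with the norm $\|\cdot\|_{\mathcal B_2}$, and let $\mathcal A_h:X_h\to X_h^*$ be the discrete operator, both defined in the context. Then there is a constant $\zeta>0$, independent of $\alpha,\beta,\lambda,c_\alpha,c_{\alpha\beta},c_\beta,t_K,t_\theta$ satisfying the conditions (A1)–(A3) listed in the context together with $C_p:=c_0-b_0\ge\frac{\alpha^2}{\lambda}$ and $C_T:=a_0-b_0\ge\frac{\beta^2}{\lambda}$, as well as of the mesh size $h$, such that $$\inf_{(\mathbf u,\xi,p,T)\in X_h}\ \sup_{(\mathbf v,\phi,q,S)\in X_h}\frac{(\mathcal A_h(\mathbf u,\xi,p,T),(\mathbf v,\phi,q,S))}{\|(\mathbf u,\xi,p,T)\|_{\mathcal B_2}\,\|(\mathbf v,\phi,q,S)\|_{\mathcal B_2}}\ge\zeta>0,$$ where infima and suprema are over nonzero elements.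
   Context: Let $\Omega\subset\mathbb R^d$, $d\in\{2,3\}$, be an open, bounded domain with Lipschitz polyhedral boundary; $(\cdot,\cdot)$ and $\|\cdot\|_0$ denote the $L^2(\Omega)$ inner product and norm (for scalar, vector or tensor functions), $\|\cdot\|_1$ the $H^1(\Omega)$ norm, and $L_0^2(\Omega)$ the mean-zero functions in $L^2(\Omega)$. Set $\mathbf V=[H_0^1(\Omega)]^d$, $Q=L^2(\Omega)$, $W=H_0^1(\Omega)$ and $\boldsymbol\varepsilon(\mathbf u)=\frac12(\nabla\mathbf u+\nabla\mathbf u^T)$. For $\xi\in L^2(\Omega)$, $\xi_m$ denotes the constant function with value $\frac1{|\Omega|}\int_\Omega\xi\,dx$, and $\xi_0=\xi-\xi_m$. Finite element spaces are taken on a shape-regular, quasi-uniform triangulation $\mathcal T_h$ of $\Omega$ with mesh size $h>0$. The paper's concrete choice is: $\mathbf V_h$ continuous piecewise $\mathbb P_2$ vector fields in $[H_0^1(\Omega)]^d$, $Q_h$ continuous piecewise $\mathbb P_1$ functions, $W_h$ continuous piecewise $\mathbb P_2$ functions in $H_0^1(\Omega)$; other stable Stokes pairs $\mathbf V_h\times Q_h$ may be used. Parameters: real numbers $\lambda,\mu,\alpha,\beta,a_0,b_0,c_0,K,\theta$ and a time step $\Delta t>0$, with the normalization $2\mu=1$. Conditions: (A1) the permeability and conductivity matrices are $K\mathbf I$ and $\theta\mathbf I$, where $K,\theta$ are positive constants (bounded above and below); (A2) $\lambda,\mu>0$; (A3) $\alpha,\beta,a_0,b_0,c_0\ge0$ and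 $a_0\ge b_0$, $c_0\ge b_0$. Notation: $$t_K=\Delta t\,K,\quad t_\theta=\Delta t\,\theta,\quad c_\alpha=c_0+\tfrac{\alpha^2}{\lambda},\quad c_{\alpha\beta}=\tfrac{\alpha\beta}{\lambda}-b_0,\quad c_\beta=a_0+\tfrac{\beta^2}{\lambda}.$$ The operator $\mathcal A_h:X_h\to X_h^*$ is given, for arguments in $X_h$, by $$\begin{aligned}(\mathcal A_h(\mathbf u,\xi,p,T),(\mathbf v,\phi,q,S))={}&(\boldsymbol\varepsilon(\mathbf u),\boldsymbol\varepsilon(\mathbf v))-(\nabla\cdot\mathbf v,\xi)-(\nabla\cdot\mathbf u,\phi)-(\lambda^{-1}\xi,\phi)+(\tfrac\alpha\lambda p,\phi)+(\tfrac\beta\lambda T,\phi)\\&+(\tfrac\alpha\lambda\xi,q)-(c_\alpha p,q)-(t_K\nabla p,\nabla q)-(c_{\alpha\beta}T,q)\\&+(\tfrac\beta\lambda\xi,S)-(c_{\alpha\beta}p,S)-(c_\beta T,S)-(t_\theta\nabla T,\nabla S).\end{aligned}$$ The parameter-dependent norm is $$\|(\mathbf u,\xi,p,T)\|_{\mathcal B_2}^2=\|\boldsymbol\varepsilon(\mathbf u)\|_0^2+\tfrac1\lambda\|\xi\|_0^2+\|\xi_0\|_0^2+C_p\|p\|_0^2+t_K\|\nabla p\|_0^2+C_T\|T\|_0^2+t_\theta\|\nabla T\|_0^2,$$ with $C_p=c_0-b_0$ and $C_T=a_0-b_0$.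
   Formalization: It is assumed in addition that ξ_0 belongs to Q_h for every ξ in Q_h (true if Q_h contains the constants); without it the claim fails, e.g. Q_h = span{1+η} with η mean-free, nonzero and orthogonal to div V_h, α = β = 0, as λ → ∞. *)

(* Defs.v *)
From HB Require Import structures.
From mathcomp Require Import all_boot all_order all_algebra.
From mathcomp Require Import all_classical all_reals all_analysis.
Import numFieldNormedType.Exports.

Set Implicit Arguments.
Unset Strict Implicit.
Unset Printing Implicit Defensive.
Import Order.TTheory GRing.Theory Num.Theory.
Local Open Scope classical_set_scope.
Local Open Scope ring_scope.

Definition rV_display : measure_display. Proof. exact. Qed.

Section rV_measurable.
Context {R : realType} {n : nat}.

Definition rV_coord (i : 'I_n) (x : 'rV[R]_n) : measurableTypeR R := x ord0 i.

Let rV_set0 : g_sigma_preimage rV_coord set0.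
Proof. exact: sigma_algebra0. Qed.

Let rV_setC A : g_sigma_preimage rV_coord A -> g_sigma_preimage rV_coord (~` A).
Proof. exact: sigma_algebraC. Qed.

Let rV_bigcup (F : _^nat) : (forall i, g_sigma_preimage rV_coord (F i)) ->
  g_sigma_preimage rV_coord (\bigcup_i F i).
Proof. exact: sigma_algebra_bigcup. Qed.

HB.instance Definition _ := @isMeasurable.Build rV_display
  'rV[R]_n (g_sigma_preimage rV_coord) rV_set0 rV_setC rV_bigcup.

Lemma measurable_rV_coord (i : 'I_n) : measurable_fun [set: 'rV[R]_n] (rV_coord i).
Proof.
move=> _ Y mY; rewrite setTI; apply: sub_sigma_algebra.
rewrite -bigcup_seq/=; exists i => /=; first by rewrite mem_index_enum.
by exists Y => //; rewrite setTI.
Qed.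

Lemma measurable_to_rV d (T : measurableType d) (f : T -> 'rV[R]_n) :
  (forall i, measurable_fun [set: T] (rV_coord i \o f)) ->
  measurable_fun [set: T] f.
Proof.
move=> mf _ Y mY; rewrite setTI.
suff H : g_sigma_preimage (fun i => rV_coord i \o f) `<=` measurable.
  by apply: H; rewrite g_sigma_preimage_comp; exists Y => //; rewrite setTI.
apply: smallest_sub; first exact: sigma_algebra_measurable.
move=> A; rewrite -bigcup_seq/= => -[i _] [B mB <-].
exact: mf.
Qed.

End rV_measurable.

Section lebesgue_rV.
Context {R : realType}.

Definition rV_cons n (p : measurableTypeR R * 'rV[R]_n) : 'rV[R]_n.+1 :=
  row_mx (p.1%:M : 'rV[R]_1) p.2.

Let rV_uncons n (x : 'rV[R]_n.+1) : measurableTypeR R * 'rV[R]_n :=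
  (x ord0 ord0, rsubmx (x : 'rV[R]_(1 + n))).

Let rV_consK n : cancel (@rV_cons n) (@rV_uncons n).
Proof.
move=> [a y]; rewrite /rV_uncons /rV_cons/=; congr (_, _); last exact: row_mxKr.
by rewrite mxE; case: splitP => //= j _; rewrite (ord1 j) mxE eqxx.
Qed.

Let rV_unconsK n : cancel (@rV_uncons n) (@rV_cons n).
Proof.
move=> x; apply/rowP => i; rewrite !mxE; case: splitP => j ij; rewrite !mxE.
  by rewrite (ord1 j) eqxx mulr1n; congr (x _ _); apply/val_inj; rewrite /= ij (ord1 j).
by congr (x _ _); apply/val_inj.
Qed.

Lemma measurable_rV_cons n : measurable_fun [set: _] (@rV_cons n).
Proof.
apply: measurable_to_rV => i.
case: (split_ordP (i : 'I_(1 + n))) => j ->.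
  rewrite [X in measurable_fun _ X](_ : _ = fst); first exact: measurable_fst.
  apply/funext => -[a y]; rewrite /= /rV_coord /rV_cons.
  by rewrite (row_mxEl (a%:M : 'rV[R]_1) y ord0 j) (ord1 j) mxE eqxx.
rewrite [X in measurable_fun _ X](_ : _ = rV_coord j \o snd); last first.
  apply/funext => -[a y]; rewrite /= /rV_coord /rV_cons.
  by rewrite (row_mxEr (a%:M : 'rV[R]_1) y ord0 j).
by apply: measurableT_comp; [exact: measurable_rV_coord|exact: measurable_snd].
Qed.

Let measurable_rV_uncons n : measurable_fun [set: _] (@rV_uncons n).
Proof.
apply/measurable_fun_pairP; split; first exact: (@measurable_rV_coord R n.+1 ord0).
apply: measurable_to_rV => i.
rewrite [X in measurable_fun _ X](_ : _ = rV_coord (rshift 1 i : 'I_n.+1)).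
  exact: measurable_rV_coord.
by apply/funext => x; rewrite /rV_coord/= mxE.
Qed.

Section lebesgue_cons.
Context {n : nat} (m : {sigma_finite_measure set 'rV[R]_n -> \bar R}).
Local Open Scope ereal_scope.

Definition lebesgue_cons : set 'rV[R]_n.+1 -> \bar R :=
  pushforward (lebesgue_measure \x m) (@rV_cons n).

Let lebesgue_cons0 : lebesgue_cons set0 = 0.
Proof. by rewrite /lebesgue_cons /pushforward preimage_set0 measure0. Qed.

Let lebesgue_cons_ge0 A : 0 <= lebesgue_cons A.
Proof. by rewrite /lebesgue_cons /pushforward; apply: integral_ge0 => // *. Qed.

Let lebesgue_cons_sigma_additive : semi_sigma_additive lebesgue_cons.
Proof.
move=> F mF tF mUF; rewrite /lebesgue_cons /pushforward preimage_bigcup.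
have mpre A : measurable A -> measurable (@rV_cons n @^-1` A).
  by move=> mA; rewrite -[X in measurable X]setTI; exact: measurable_rV_cons.
apply: measure_semi_sigma_additive.
- by move=> k; exact: mpre.
- apply/trivIsetP => /= i j _ _ ij; rewrite -preimage_setI.
  by move/trivIsetP : tF => /(_ _ _ _ _ ij) ->//; rewrite preimage_set0.
- by rewrite -preimage_bigcup; exact: mpre.
Qed.

HB.instance Definition _ := isMeasure.Build _ _ _ lebesgue_cons
  lebesgue_cons0 lebesgue_cons_ge0 lebesgue_cons_sigma_additive.

Let lebesgue_cons_sigma_finite : sigma_finite setT lebesgue_cons.
Proof.
pose leb := (lebesgue_measure : {sigma_finite_measure set (measurableTypeR R) -> \bar R}).
have /sigma_finiteP[F [TF ndF Foo]] := sigma_finiteT leb.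
have /sigma_finiteP[G [TG ndG Goo]] := sigma_finiteT m.
exists (fun k => @rV_uncons n @^-1` (F k `*` G k)).
  rewrite -preimage_bigcup -[LHS](@preimage_setT _ _ (@rV_uncons n)).
  congr (_ @^-1` _); rewrite -setXTT TF TG predeqE => -[x y]; split.
    move=> [/= [j _ Fjx] [k _ Gky]]; exists (maxn j k) => //; split.
    - by move: x Fjx; exact/subsetPset/ndF/leq_maxl.
    - by move: y Gky; exact/subsetPset/ndG/leq_maxr.
  by move=> [k _ []/= ? ?]; split; exists k.
move=> k; have [mFk Fkoo] := Foo k; have [mGk Gkoo] := Goo k; split.
  rewrite -[X in measurable X]setTI; apply: measurable_rV_uncons => //.
  exact: measurableX.
rewrite /lebesgue_cons /pushforward (_ : _ @^-1` _ = F k `*` G k).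
  by rewrite product_measure1E// lte_mul_pinfty// ge0_fin_numE.
by rewrite -comp_preimage (_ : _ \o _ = id)//; exact/funext/rV_consK.
Qed.

HB.instance Definition _ := Measure_isSigmaFinite.Build _ _ _ lebesgue_cons
  lebesgue_cons_sigma_finite.

End lebesgue_cons.

Fixpoint lebesgue_rV n : {sigma_finite_measure set 'rV[R]_n -> \bar R} :=
  if n is n'.+1 then lebesgue_cons (lebesgue_rV n') else \d_(0 : 'rV[R]_0).

End lebesgue_rV.

Section domain.
Context {R : realType} {d : nat}.
Implicit Types (Om : set 'rV[R]_d) (x y : 'rV[R]_d).

(* The library norm on ['rV[R]_d] is the sup norm. *)
Definition edot x y : R := \sum_(i < d) x ord0 i * y ord0 i.
Definition enorm x : R := Num.sqrt (edot x x).

Definition frontier Om : set 'rV[R]_d := closure Om `\` Om°.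

(* Near each boundary point [x0], in the coordinates given by a unit vector [n]
   and its orthogonal complement, [Om] is the open epigraph of a Lipschitz
   function. *)
Definition lipschitz_boundary Om : Prop :=
  forall x0, frontier Om x0 ->
  exists (n : 'rV[R]_d) (g : 'rV[R]_d -> R) (L r : R),
  [/\ enorm n = 1, 0 < r,
      forall y z, `|g y - g z| <= L * enorm (y - z) &
      forall y, enorm y < r ->
        (Om (x0 + y) <-> g (y - edot y n *: n) < edot y n)].

Definition polyhedral_boundary Om : Prop :=
  exists2 s : seq ('rV[R]_d * R), forall p, p \in s -> p.1 != 0 &
  forall x, frontier Om x -> exists2 p, p \in s & edot p.1 x = p.2.

Record lipschitz_polyhedral_domain Om : Prop := {
  domain_open : open Om;
  domain_bounded : bounded_set Om;
  domain_connected : connected Om;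
  domain_nonempty : Om !=set0;
  domain_lipschitz : lipschitz_boundary Om;
  domain_polyhedral : polyhedral_boundary Om }.

End domain.

Section sobolev.
Context {R : realType} {d : nat} (Om : set 'rV[R]_d).
Local Notation E := 'rV[R]_d.
Local Notation mu := (lebesgue_rV d : {measure set E -> \bar R}).
Implicit Types (f g phi xi : E -> R) (u v : E -> 'rV[R]_d).

(* Elements of L^2 are represented by functions defined on the whole space, of
   which only the restriction to [Om], up to a.e. equality, is relevant. *)
Definition L2 : set (E -> R) := [set f |
  measurable_fun Om (f : E -> measurableTypeR R) /\
  mu.-integrable Om (fun x => ((f x) ^+ 2)%:E)].

Definition ip f g : R := \int[mu]_(x in Om) (f x * g x).
Definition l2norm f : R := Num.sqrt (ip f f).

Definition ipmx {m n} (F G : E -> 'M[R]_(m, n)) : R :=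
  \int[mu]_(x in Om) (\sum_(i < m) \sum_(j < n) F x i j * G x i j).
Definition l2normmx {m n} (F : E -> 'M[R]_(m, n)) : R := Num.sqrt (ipmx F F).

Definition nonzero_ae {V : nmodType} (f : E -> V) : Prop :=
  ~ f = (fun=> 0) %[ae mu in Om].

Definition mean f : R := (\int[mu]_(x in Om) f x) / fine (mu Om).
Definition mean_free f : E -> R := fun x => f x - mean f.
Definition L20 : set (E -> R) := [set f | L2 f /\ \int[mu]_(x in Om) f x = 0].

Definition partial (i : 'I_d) f : E -> R := 'D_(delta_mx ord0 i : E) f.

Definition smooth f : Prop := forall s : seq 'I_d,
  continuous (foldr partial f s) /\
  forall i x, derivable (foldr partial f s) x (delta_mx ord0 i : E).

Definition supp f : set E := closure [set x | f x != 0].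

Definition test_fun : set (E -> R) :=
  [set phi | [/\ smooth phi, compact (supp phi) & supp phi `<=` Om]].

Definition weak_grad f : set (E -> 'rV[R]_d) := [set G |
  (forall i, L2 (fun x => G x ord0 i)) /\
  forall i phi, test_fun phi ->
    ip f (partial i phi) = - ip (fun x => G x ord0 i) phi].

Definition H1 : set (E -> R) := [set f | L2 f /\ weak_grad f !=set0].

(* A choice of weak gradient (unique up to a.e. equality) of [f] in [H1]. *)
Definition grad f : E -> 'rV[R]_d := xget (fun=> 0) (weak_grad f).

Definition h1norm f : R := Num.sqrt (l2norm f ^+ 2 + l2normmx (grad f) ^+ 2).

Definition H10 : set (E -> R) := [set f | H1 f /\
  forall e, 0 < e -> exists2 phi, test_fun phi & h1norm (fun x => f x - phi x) < e].

Definition component u (i : 'I_d) : E -> R := fun x => u x ord0 i.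
Definition H10v : set (E -> 'rV[R]_d) := [set u | forall i, H10 (component u i)].
Definition h1normv u : R := Num.sqrt (\sum_(i < d) h1norm (component u i) ^+ 2).

Definition jac u : E -> 'M[R]_d := fun x => \matrix_(i, j) grad (component u i) x ord0 j.
Definition strain u : E -> 'M[R]_d := fun x => 2^-1 *: (jac u x + (jac u x)^T).
Definition diverg u : E -> R := fun x => \tr (jac u x).

End sobolev.

Section finite_elements.
Context {R : realType} {d : nat}.
Local Notation E := 'rV[R]_d.

(* A simplex is given by its [d.+1] vertices, the rows of a matrix. *)
Definition simplex := 'M[R]_(d.+1, d).
Implicit Types (K L : simplex) (T : seq simplex).

Definition face K (J : {set 'I_d.+1}) : set E :=
  [set lam *m K | lam in [set lam : 'rV[R]_d.+1 |
     [/\ forall i, 0 <= lam ord0 i, forall i, i \notin J -> lam ord0 i = 0 &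
         \sum_i lam ord0 i = 1]]].
Definition body K : set E := face K [set: 'I_d.+1]%SET.

Definition affinely_free K : Prop := forall lam : 'rV[R]_d.+1,
  lam *m K = 0 -> \sum_i lam ord0 i = 0 -> lam = 0.

(* [J] and [J'] may be empty, [face K set0] being the empty set. *)
Record triangulation (Om : set E) T : Prop := {
  triangulation_free : forall K, K \in T -> affinely_free K;
  triangulation_cover : closure Om = \bigcup_(K in [set` T]) body K;
  triangulation_conforming : forall K L, K \in T -> L \in T ->
    exists J J', face K J = face L J' /\ body K `&` body L = face K J }.

Definition diam K : R :=
  sup [set enorm (x - y) | x in body K & y in body K].
(* Diameter of the largest inscribed ball. *)
Definition indiam K : R :=
  sup [set 2 * r | r in [set r | exists x : E,
                           forall y, enorm (y - x) < r -> body K y]].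
Definition meshsize T : R := \big[Num.max/0]_(K <- T) diam K.

Definition shape_regular (sigma : R) T : Prop :=
  forall K, K \in T -> diam K <= sigma * indiam K.
Definition quasi_uniform (tau : R) T : Prop :=
  forall K, K \in T -> meshsize T <= tau * diam K.

Definition poly_fun (k : nat) : set (E -> R) := [set p |
  exists c : {ffun 'I_d -> 'I_k.+1} -> R, forall x : E,
  p x = \sum_(m : {ffun 'I_d -> 'I_k.+1} | (\sum_i m i <= k)%N)
          c m * \prod_(i < d) x ord0 i ^+ m i].

Definition piecewise_poly (k : nat) T (f : E -> R) : Prop :=
  forall K, K \in T -> exists2 p, poly_fun k p & forall x, (body K)° x -> f x = p x.

Record fe_space T (W : set (E -> R)) : Prop := {
  fe_zero : W (fun=> 0);
  fe_lin : forall a f g, W f -> W g -> W (fun x => a * f x + g x);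
  fe_poly : exists k, forall f, W f -> piecewise_poly k T f }.

Record fe_vspace T (W : set (E -> 'rV[R]_d)) : Prop := {
  fev_zero : W (fun=> 0);
  fev_lin : forall a f g, W f -> W g -> W (fun x => a *: f x + g x);
  fev_poly : exists k, forall f, W f -> forall i, piecewise_poly k T (component f i) }.

End finite_elements.
Arguments simplex : clear implicits.

Definition infsup {R : realType} {X Y : Type} (b : X -> Y -> R)
    (normX : X -> R) (normY : Y -> R) (A : set X) (B : set Y) : \bar R :=
  ereal_inf [set ereal_sup [set (b x y / (normX x * normY y))%:E | y in B] | x in A].

Section thermo_poroelasticity.
Context {R : realType} {d : nat} (Om : set 'rV[R]_d).
Local Notation E := 'rV[R]_d.

(* [pmu] enters neither [Ah] nor [normB2]: they are written for 2 mu = 1. *)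
Record params := Params {
  plam : R; pmu : R; palpha : R; pbeta : R; pa0 : R; pb0 : R; pc0 : R;
  pK : R; ptheta : R; pdt : R }.
Implicit Type P : params.

Record admissible P : Prop := {
  adm_normalized : 2 * pmu P = 1;
  adm_dt : 0 < pdt P;
  adm_A1 : 0 < pK P /\ 0 < ptheta P;
  adm_A2 : 0 < plam P /\ 0 < pmu P;
  adm_A3 : [/\ 0 <= palpha P, 0 <= pbeta P, 0 <= pa0 P, 0 <= pb0 P & 0 <= pc0 P];
  adm_A3' : pb0 P <= pa0 P /\ pb0 P <= pc0 P }.

Definition tK P := pdt P * pK P.
Definition ttheta P := pdt P * ptheta P.
Definition c_alpha P := pc0 P + palpha P ^+ 2 / plam P.
Definition c_alphabeta P := palpha P * pbeta P / plam P - pb0 P.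
Definition c_beta P := pa0 P + pbeta P ^+ 2 / plam P.
Definition Cp P := pc0 P - pb0 P.
Definition CT P := pa0 P - pb0 P.

Record state := State { su : E -> 'rV[R]_d; sxi : E -> R; sp : E -> R; sT : E -> R }.
Implicit Types x y : state.

Definition Xh (Vh : set (E -> 'rV[R]_d)) (Qh Wh : set (E -> R)) : set state :=
  [set x | [/\ Vh (su x), Qh (sxi x), Wh (sp x) & Wh (sT x)]].

Definition nonzero_state x : Prop :=
  [\/ nonzero_ae Om (su x), nonzero_ae Om (sxi x), nonzero_ae Om (sp x)
    | nonzero_ae Om (sT x)].

Definition Ah P x y : R :=
  let: State u xi p t := x in let: State v phi q s := y in
    ipmx Om (strain Om u) (strain Om v) - ip Om (diverg Om v) xi - ip Om (diverg Om u) phi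
    - (plam P)^-1 * ip Om xi phi + palpha P / plam P * ip Om p phi + pbeta P / plam P * ip Om t phi
  + palpha P / plam P * ip Om xi q - c_alpha P * ip Om p q
    - tK P * ipmx Om (grad Om p) (grad Om q) - c_alphabeta P * ip Om t q
  + pbeta P / plam P * ip Om xi s - c_alphabeta P * ip Om p s - c_beta P * ip Om t s
    - ttheta P * ipmx Om (grad Om t) (grad Om s).

Definition normB2 P x : R :=
  let: State u xi p t := x in
  Num.sqrt (l2normmx Om (strain Om u) ^+ 2
    + (plam P)^-1 * l2norm Om xi ^+ 2 + l2norm Om (mean_free Om xi) ^+ 2
    + Cp P * l2norm Om p ^+ 2 + tK P * l2normmx Om (grad Om p) ^+ 2
    + CT P * l2norm Om t ^+ 2 + ttheta P * l2normmx Om (grad Om t) ^+ 2).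

End thermo_poroelasticity.
Arguments params : clear implicits.

(* Main.v *)
Require Import Defs.
From mathcomp Require Import all_boot all_order all_algebra.
From mathcomp Require Import all_classical all_reals all_analysis.
From mathcomp Require Import measurable_realfun lra ring.
Import numFieldNormedType.Exports.
Import Order.TTheory GRing.Theory Num.Theory.
Set Implicit Arguments.
Unset Strict Implicit.
Unset Printing Implicit Defensive.
Local Open Scope classical_set_scope.
Local Open Scope ring_scope.

(** Fix [x = (u, xi, p, T)], write [N] for its norm, [xi0] for the mean-free part
of [xi] and [Z] for the part of [N ^ 2] other than [|xi0| ^ 2], so that
[N ^ 2 = Z + |xi0| ^ 2]. Two test elements suffice, according to which part of
the norm dominates.

- If [|xi0| ^ 2 <= (4 / gamma) ^ 2 * Z], take [y = (u, - xi, - p, - T)], which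
  has the norm of [x]. The coupling of [u] and [xi] cancels and the form becomes
  a sum of [|eps u| ^ 2], the diffusion terms, the square
  [|xi - alpha p - beta T| ^ 2 / lambda] and the quadratic form of
  [(c0, - b0, a0)] in [(p, T)]. The assumptions [alpha ^ 2 / lambda <= Cp] and
  [beta ^ 2 / lambda <= CT] let [Cp |p| ^ 2] and [CT |T| ^ 2] pay for the
  difference between that square and [|xi| ^ 2 / lambda], so the form is at least
  [Z / 4] ([flip_energy], [Ah_flip]).

- Otherwise [|eps u| <= gamma / 4 * |xi0|]. The inf-sup condition applied to
  [- xi0] gives a displacement [w], and [y = (w, 0, 0, 0)] gives
  [(eps u, eps w) - (div w, xi) >= (gamma / 2 - gamma / 4) |xi0| |eps w|]
  ([pressure_witness], [pressure_ratio]).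

The gradient in the form is an arbitrary choice of a weak gradient, so linearity
of the form and the meaning of the norm rest on uniqueness of weak gradients.
Uniqueness is the fundamental lemma of the calculus of variations
([test_orthogonal_eq0]): the indicator of an open box is a bounded pointwise
limit of test functions [boxbump], products of rescaled copies of
[exp (- 1 / t)], and boxes generate the Borel sets.

Elements of [H10] are then limits of test functions, which gives the two facts
needed about them: [int div w = 0] ([H10_integral_pgrad]), so that [(div w, xi)]
sees only [xi0], and a Poincare inequality in a single direction
([test_poincare], [H10_pgrad_eq0]). The latter shows that nonzero elements have
positive norm; for the displacement, [eps u = 0] makes the diagonal entry
[d_k u_k] vanish, and the inequality in direction [k] gives [u_k = 0]. Both facts
come from [int d_i f = 0] for compactly supported [f], which is the
one-dimensional fundamental theorem of calculus and Fubini
([integral_partial_eq0]). *)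

(** * Boxes and Borel sets of [R^n] *)

Section boxes.
Context {R : realType} {n : nat}.
Local Notation E := 'rV[R]_n.
Implicit Types (a b x : E) (U : set E).

Definition obox a b : set E :=
  [set x | forall i, a ord0 i < x ord0 i < b ord0 i].
Definition cbox a b : set E :=
  [set x | forall i, a ord0 i <= x ord0 i <= b ord0 i].

Lemma obox_sub_cbox a b : obox a b `<=` cbox a b.
Proof. by move=> x xab i; have /andP[/ltW-> /ltW->] := xab i. Qed.

Lemma obox_bigcap a b :
  obox a b = \big[setI/setT]_(i < n) (@rV_coord R n i @^-1` `]a ord0 i, b ord0 i[).
Proof.
rewrite -bigcap_seq; apply/seteqP; split => [x abx i _|x abx i].
  by rewrite /= in_itv/=; exact: abx.
by have := abx i; rewrite /= mem_index_enum in_itv/=; exact.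
Qed.

Lemma measurable_obox a b : measurable (obox a b).
Proof.
rewrite obox_bigcap; apply: bigsetI_measurable => i _.
by rewrite -[X in measurable X]setTI; exact: measurable_rV_coord.
Qed.

Lemma compact_cbox a b : compact (cbox a b).
Proof.
rewrite (_ : cbox a b = [set v | forall i, `[a ord0 i, b ord0 i]%classic (v ord0 i)]).
  apply: (@rV_compact _ _ (fun i => `[a ord0 i, b ord0 i]%classic)) => i.
  exact: segment_compact.
by apply/seteqP; split => x abx i; move: (abx i); rewrite /= in_itv.
Qed.

Lemma closed_cbox a b : closed (cbox a b).
Proof.
exact: (compact_closed (@norm_hausdorff R E) (@compact_cbox a b)).
Qed.

(** Numbering rational corners by [pickle] makes the covering of an open set by
boxes countable; numbers encoding no pair of corners get a default pair. *)
Definition rat_corners (k : nat) : E * E :=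
  if (unpickle k : option ('rV[rat]_n * 'rV[rat]_n)) is Some (p, q)
  then (map_mx ratr p, map_mx ratr q) else (0, 0).

Definition rat_obox k := obox (rat_corners k).1 (rat_corners k).2.
Definition rat_cbox k := cbox (rat_corners k).1 (rat_corners k).2.

(** The closed boxes lie in [U], so that the bumps of every box of the covering are
test functions on [U]. *)
Lemma open_bigcup_rat_obox U : open U ->
  U = \bigcup_(k in [set k | rat_cbox k `<=` U]) rat_obox k.
Proof.
rewrite openE => oU; apply/seteqP; split; last first.
  by move=> x [k /= kU /obox_sub_cbox]; exact: kU.
move=> x /oU; rewrite /interior -nbhs_ballE => -[/= e e0 eU].
have p_ i : {p : rat | x ord0 i - e < ratr p < x ord0 i}.
  have /rat_in_itvoo/cid[p] : x ord0 i - e < x ord0 i by rewrite ltrBlDr ltrDl.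
  by rewrite in_itv; exists p.
have q_ i : {q : rat | x ord0 i < ratr q < x ord0 i + e}.
  have /rat_in_itvoo/cid[q] : x ord0 i < x ord0 i + e by rewrite ltrDl.
  by rewrite in_itv; exists q.
pose p : 'rV[rat]_n := \row_i sval (p_ i); pose q : 'rV[rat]_n := \row_i sval (q_ i).
exists (pickle (p, q)).
  move=> y; rewrite /rat_cbox /rat_corners pickleK/= => ypq; apply: eU.
  split => //= r i; have := ypq i; rewrite !mxE !(ord1 r) /ball/=.
  case: (p_ i) (q_ i) => p0 /= /andP[hp _] [q0 /= /andP[_ hq]] /andP[hp' hq'].
  by rewrite ltr_norml; lra.
rewrite /rat_obox /rat_corners pickleK/= => i; rewrite !mxE.
by case: (p_ i) (q_ i) => p0 /= /andP[_ ->] [q0 /= /andP[-> _]].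
Qed.

Lemma open_measurable_rV U : open U -> measurable U.
Proof.
move=> /open_bigcup_rat_obox ->; apply: bigcup_measurable => k _.
exact: measurable_obox.
Qed.

Lemma continuous_measurable_rV (f : E -> measurableTypeR R) (D : set E) :
  measurable D -> continuous (f : E -> R) -> measurable_fun D f.
Proof.
move=> mD cf; apply: (measurability _ (RGenOpens.measurableE R)).
move=> _ [_ [a [b ->] <-]]; apply: measurableI => //.
apply: open_measurable_rV; apply: open_comp; last exact: interval_open.
by move=> x _; exact: cf.
Qed.

End boxes.

(** * Product structure of [R^n] and bounded sets *)

Lemma continuous_to_rV {R : realType} (T : topologicalType) n (f : T -> 'rV[R]_n) :
  (forall i, continuous (fun x => f x ord0 i)) -> continuous f.
Proof.
move=> cf x; apply/cvg_ballP => e e0.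
have : \forall y \near x, forall i, ball (f x ord0 i) e (f y ord0 i).
  by apply: filter_forall => i; apply: (cvg_ball (cf i x)).
by apply: filterS => y fy; split => // r i; rewrite (ord1 r); exact: fy.
Qed.

(** A derivative along [v] only sees the line through [x]; this moves derivatives
between [R^n] and a line or a coordinate hyperplane. *)
Lemma is_derive_slice {R : realType} (V V' W : normedModType R)
    (F : V -> W) (G : V' -> W) x v x' v' l :
  (forall h, G (h *: v' + x') = F (h *: v + x)) ->
  is_derive x v F l -> is_derive x' v' G l.
Proof.
move=> GF; have GFx : G x' = F x by have := GF 0; rewrite !scale0r !add0r.
have quotE : (fun h => h^-1 *: ((G \o shift x') (h *: v') - G x')) =
             (fun h => h^-1 *: ((F \o shift x) (h *: v) - F x)).
  by apply/funext => h; rewrite /= GF GFx.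
move=> [dF <-]; apply: DeriveDef; rewrite /derivable /derive quotE //.
Qed.

Section cons.
Context {R : realType} {n : nat}.

Lemma rV_cons0 (t : R) (y : 'rV[R]_n) : rV_cons (t, y) ord0 ord0 = t.
Proof.
by rewrite mxE; case: splitP => //= j _; rewrite (ord1 j) mxE eqxx.
Qed.

Lemma rV_consS (t : R) (y : 'rV[R]_n) (j : 'I_n) :
  rV_cons (t, y) ord0 (lift ord0 j) = y ord0 j.
Proof.
rewrite mxE; case: splitP => k; last by case => kj; congr (y _ _); apply/val_inj.
by rewrite /bump /= (ord1 k).
Qed.

Lemma continuous_rV_consl (y : 'rV[R]_n) : continuous (fun t : R => rV_cons (t, y)).
Proof.
apply: continuous_to_rV => i; case: (unliftP ord0 i) => [j ->|->].
  by under eq_fun do rewrite rV_consS; exact: cst_continuous.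
by under eq_fun do rewrite rV_cons0; move=> x; exact: cvg_id.
Qed.

Lemma continuous_rV_consr (t : R) : continuous (fun y : 'rV[R]_n => rV_cons (t, y)).
Proof.
apply: continuous_to_rV => i; case: (unliftP ord0 i) => [j ->|->].
  by under eq_fun do rewrite rV_consS; exact: coord_continuous.
by under eq_fun do rewrite rV_cons0; exact: cst_continuous.
Qed.

Lemma rV_cons_shift0 (h t : R) (y : 'rV[R]_n) :
  rV_cons (h *: (1 : R) + t, y) =
  h *: (delta_mx ord0 ord0 : 'rV[R]_n.+1) + rV_cons (t, y).
Proof.
apply/rowP => i; rewrite [RHS]mxE [X in _ = X + _]mxE [X in _ = _ * X + _]mxE eqxx /=.
case: (unliftP ord0 i) => [j ->|->].
  by rewrite !rV_consS mulr0 add0r.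
by rewrite !rV_cons0.
Qed.

Lemma rV_cons_shiftS (h t : R) (y : 'rV[R]_n) (j : 'I_n) :
  rV_cons (t, h *: (delta_mx ord0 j : 'rV[R]_n) + y) =
  h *: (delta_mx ord0 (lift ord0 j) : 'rV[R]_n.+1) + rV_cons (t, y).
Proof.
apply/rowP => i; rewrite [RHS]mxE [X in _ = X + _]mxE [X in _ = _ * X + _]mxE eqxx /=.
case: (unliftP ord0 i) => [k ->|->].
  by rewrite !rV_consS !mxE eqxx /= (inj_eq lift_inj).
by rewrite !rV_cons0 (negbTE (neq_lift _ _)) mulr0 add0r.
Qed.

End cons.

Section cube.
Context {R : realType}.
Local Notation mu n := (lebesgue_rV n : {measure set 'rV[R]_n -> \bar R}).

Definition cube n (M : R) : set 'rV[R]_n := cbox (const_mx (- M)) (const_mx M).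
Arguments cube n M _ : clear implicits.

Lemma cubeE n (M : R) x : cube n M x <-> forall i, `|x ord0 i| <= M.
Proof. by split => xM i; move: (xM i); rewrite !mxE ler_norml. Qed.

Lemma measurable_cube n (M : R) : measurable (cube n M).
Proof.
rewrite -[X in measurable X]setCK; apply: measurableC; apply: open_measurable_rV.
by apply: closed_openC; exact: closed_cbox.
Qed.

Lemma cube_lty n (M : R) : (lebesgue_rV n (cube n M) < +oo)%E.
Proof.
elim: n => [|n IHn] /=; first by rewrite diracE ltry.
rewrite /lebesgue_cons /pushforward.
have -> : @rV_cons R n @^-1` cube n.+1 M = `[- M, M]%classic `*` cube n M.
  apply/seteqP; split => [[t y] /cubeE xM|[t y] [/= tM /cubeE yM]].
    split => /=; first by have := xM ord0; rewrite rV_cons0 in_itv/= ler_norml.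
    by apply/cubeE => i; have := xM (lift ord0 i); rewrite rV_consS.
  apply/cubeE => i; case: (unliftP ord0 i) => [j ->|->].
    by rewrite rV_consS.
  by rewrite rV_cons0 ler_norml; move: tM; rewrite in_itv.
rewrite product_measure1E//; last exact: measurable_cube.
rewrite lte_mul_pinfty//; last first.
rewrite /= lebesgue_measure_itv; case: ifP => //= _.
Qed.

Lemma bounded_sub_cube n (A : set 'rV[R]_n) : bounded_set A ->
  exists2 M : R, 0 < M & A `<=` cube n M.
Proof.
move=> [M [_ AM]]; exists (`|M| + 1); first by rewrite ltr_wpDl.
move=> x Ax; apply/cubeE => i.
have : `|x| <= `|M| + 1 by apply: AM Ax; rewrite (le_lt_trans (ler_norm M))// ltrDl.
apply: le_trans; rewrite [leRHS]/Num.norm/= mx_normrE.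
by apply/bigmax_geP; right => /=; exists (ord0, i).
Qed.

Lemma bounded_lty n (A : set 'rV[R]_n) : measurable A -> bounded_set A ->
  (lebesgue_rV n A < +oo)%E.
Proof.
move=> mA /bounded_sub_cube[M _ AM]; apply: le_lt_trans (cube_lty n M).
by apply: le_measure => //; rewrite inE //; exact: measurable_cube.
Qed.

Lemma continuous_integrable n (f : 'rV[R]_n -> R) (M : R) :
  continuous f -> (forall x, ~ cube n M x -> f x = 0) ->
  (mu n).-integrable setT (EFin \o f).
Proof.
move=> cf f0; have -> : EFin \o f = (EFin \o f) \_ (cube n M).
  apply/funext => x; rewrite patchE; case: ifPn => //; rewrite notin_setE => /f0.
  by move=> /= ->.
apply/(integrable_mkcond _ (measurable_cube M)).1.
apply: measurable_bounded_integrable; [exact: measurable_cube|exact: cube_lty|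
  by apply: continuous_measurable_rV => //; exact: measurable_cube|].
have : compact (f @` cube n M).
  apply: continuous_compact; last exact: compact_cbox.
  exact/continuous_subspaceT/cf.
move=> /compact_bounded[N [Nr fN]]; exists N; split => // L /fN fL x Cx.
by apply: fL; exists x.
Qed.

End cube.
Arguments cube {R} n M _.

(** * Integrals of partial derivatives *)

Section divergence.
Context {R : realType}.
Local Notation mu n := (lebesgue_rV n : {measure set 'rV[R]_n -> \bar R}).

Lemma integral_derive_eq0 (f g : R -> R) (M : R) : 0 < M ->
  continuous g -> (forall t : R, is_derive t 1 f (g t)) ->
  (forall t, M < `|t| -> f t = 0) -> (forall t, M < `|t| -> g t = 0) ->
  (\int[lebesgue_measure]_t (g t)%:E = 0)%E.
Proof.
move=> M0 cg fg f0 g0.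
have gE : EFin \o g = (EFin \o g) \_ `[- (M + 1), M + 1]%classic.
  apply/funext => t; rewrite patchE; case: ifPn => //.
  rewrite notin_setE /= in_itv/= -ler_norml => /negP; rewrite -ltNge => tM.
  by rewrite g0//; lra.
have cf : continuous f.
  move=> t; apply: differentiable_continuous; apply/derivable1_diffP.
  exact: ex_derive.
rewrite [LHS](_ : _ = \int[lebesgue_measure]_t (EFin \o g) t)%E// gE.
rewrite -integral_mkcond (@continuous_FTC2 _ g f) //.
- by rewrite !f0 ?subee// ?normrN ger0_norm; lra.
- by lra.
- exact: continuous_subspaceT.
- split; first by move=> t _; exact: ex_derive.
    by apply: cvg_at_right_filter; exact: cf.
  by apply: cvg_at_left_filter; exact: cf.
- by move=> t _; rewrite derive1E; exact: derive_val.
Qed.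

(** Induction on the dimension by Fubini: for the first coordinate the inner
integral is that of a derivative of a compactly supported function of one
variable, for the others the induction hypothesis applies to each slice. *)
Lemma integral_partial_eq0 n (F G : 'rV[R]_n -> R) (i : 'I_n) (M : R) : 0 < M ->
  continuous G -> (forall x, is_derive x (delta_mx ord0 i : 'rV[R]_n) F (G x)) ->
  (forall x, ~ cube n M x -> F x = 0) -> (forall x, ~ cube n M x -> G x = 0) ->
  (\int[mu n]_x (G x)%:E = 0)%E.
Proof.
move=> M0; elim: n => [|n IHn] in F G i *; first by case: i.
move=> cG dF F0 G0.
have iG := continuous_integrable cG G0.
have mG : measurable_fun setT (EFin \o G).
  by apply/measurable_EFinP; apply: continuous_measurable_rV.
pose m := (lebesgue_measure : {sigma_finite_measure set (measurableTypeR R) -> \bar R}).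
pose m' := (lebesgue_rV n : {sigma_finite_measure set 'rV[R]_n -> \bar R}).
have iGc : (m \x m')%E.-integrable setT ((EFin \o G) \o @rV_cons R n).
  apply/integrableP; split.
    by apply: measurableT_comp => //; exact: measurable_rV_cons.
  have /integrableP[_] := iG; rewrite /= /lebesgue_cons.
  rewrite ge0_integral_pushforward//.
    exact: measurable_rV_cons.
  apply/measurable_EFinP; apply: (@measurableT_comp _ _ _ _ _ _ (@Num.norm R R)) => //.
  exact: continuous_measurable_rV.
have -> : (\int[mu n.+1]_x (G x)%:E =
           \int[(m \x m')]_p ((EFin \o G) \o @rV_cons R n) p)%E.
  exact: (integral_pushforward (@measurable_rV_cons R n) mG).
case: (unliftP ord0 i) dF => [j ->|->] dF.
  rewrite -integral12_prod_meas1//; apply: integral0_eq => t _.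
  rewrite /fubini_F/=.
  apply: (IHn (fun y => F (rV_cons (t, y))) (fun y => G (rV_cons (t, y))) j).
  - move=> y; apply: (continuous_comp (@continuous_rV_consr R n t y)); exact: cG.
  - move=> y; apply: is_derive_slice (dF (rV_cons (t, y))) => h.
    by rewrite rV_cons_shiftS.
  - move=> y Cy; apply: F0; apply: contra_not Cy => /cubeE Cty.
    by apply/cubeE => k; have := Cty (lift ord0 k); rewrite rV_consS.
  - move=> y Cy; apply: G0; apply: contra_not Cy => /cubeE Cty.
    by apply/cubeE => k; have := Cty (lift ord0 k); rewrite rV_consS.
rewrite -integral21_prod_meas1//; apply: integral0_eq => y _.
rewrite /fubini_G/=.
have out t : M < `|t| -> ~ cube n.+1 M (rV_cons (t, y)).
  by rewrite ltNge => /negP tM /cubeE /(_ ord0); rewrite rV_cons0.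
apply: (@integral_derive_eq0 (fun t => F (rV_cons (t, y))) _ M) => //.
- move=> t; apply: (continuous_comp (@continuous_rV_consl R n y t)); exact: cG.
- move=> t; apply: is_derive_slice (dF (rV_cons (t, y))) => h.
  by rewrite rV_cons_shift0.
- by move=> t /out/F0.
- by move=> t /out/G0.
Qed.

End divergence.

(** * Smooth functions supported in a box *)

Section flat.
Context {R : realType}.
Implicit Types (x y : R) (k : nat).

(** The derivatives of [exp (- 1 / t)], extended by [0], are combinations of these
functions. *)
Definition flat k x : R := if 0 < x then x^-1 ^+ k * expR (- x^-1) else 0.

Lemma flat_le0 k x : x <= 0 -> flat k x = 0.
Proof. by move=> x0; rewrite /flat ltNge x0. Qed.

Lemma flat_gt0 k x : 0 < x -> flat k x = x^-1 ^+ k * expR (- x^-1).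
Proof. by rewrite /flat => ->. Qed.

(** [expR y >= (1 + y / m) ^ m >= (y / m) ^ m] with [m = k + 2]. *)
Lemma expRN_exprn_bound k y : 0 < y ->
  y ^+ k.+1 * expR (- y) <= k.+2%:R ^+ k.+2 * y^-1.
Proof.
move=> y0; rewrite expRN ler_pdivrMr ?expR_gt0// -mulrA.
rewrite -(ler_pM2l y0) [leRHS]mulrCA -exprS mulVKf ?gt_eqF//.
have := expRM_natl k.+2 (y / k.+2%:R); rewrite mulrC divfK ?pnatr_eq0// => ->.
rewrite -exprMn lerXn2r ?nnegrE ?(ltW y0)//.
rewrite mulrC -ler_pdivrMr ?ltr0n//; apply: le_trans (expR_ge1Dx _).
by rewrite lerDr.
Qed.

Lemma flat_bound k x : `|flat k.+1 x| <= k.+2%:R ^+ k.+2 * `|x|.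
Proof.
have [x0|x0] := ltP 0 x; last by rewrite flat_le0// normr0 mulr_ge0.
have y0 : 0 < x^-1 by rewrite invr_gt0.
rewrite flat_gt0// ger0_norm; last by rewrite mulr_ge0 ?expR_ge0 ?exprn_ge0 ?(ltW y0).
by rewrite (ger0_norm (ltW x0)); have := expRN_exprn_bound k y0; rewrite invrK.
Qed.

(** At [0] the difference quotient of [flat k] is [flat k.+1], which tends to [0]
because [flat_bound] makes it [O(t)]. *)
Lemma is_derive_flat k x :
  is_derive x (1 : R) (flat k) (flat k.+2 x - k%:R * flat k.+1 x).
Proof.
have [x0|x0|->] := ltgtP x 0.
- rewrite !flat_le0 ?ltW// mulr0 subr0.
  apply: (@near_eq_is_derive _ _ _ (cst 0)).
  by near=> y; rewrite flat_le0// ltW//; near: y; exact: lt_nbhsl.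
- rewrite !flat_gt0//.
  apply: (@near_eq_is_derive _ _ _ (fun y => y^-1 ^+ k * expR (- y^-1))).
    by near=> y; rewrite flat_gt0//; near: y; exact: lt_nbhsr.
  have dV : is_derive x (1 : R) (fun y : R => y^-1) (- x ^- 2).
    have := @is_deriveV _ id x 1 1 (lt0r_neq0 x0) (is_derive_id _ _).
    by rewrite /GRing.scale/= mulr1.
  have dE : is_derive x (1 : R) (fun y : R => expR (- y^-1)) (expR (- x^-1) * x ^- 2).
    have -> : x ^- 2 = - (- x ^- 2) by rewrite opprK.
    apply: (@is_derive1_comp _ expR (fun y => - y^-1)).
  have -> : (fun y => y^-1 ^+ k * expR (- y^-1)) =
            ((fun y => y^-1) ^+ k * (fun y => expR (- y^-1)))%R.
    by apply/funext => y; rewrite /GRing.mul/= exprfctE.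
  apply: is_derive_eq (is_deriveM (is_deriveX k dV) dE) _.
  rewrite /GRing.scale/= exprfctE; rewrite -!exprVn; move: (expR _) => a; move: (x^-1) => b.
  case: k => [|k] /=; first by ring.
  by rewrite !exprS; move: (b ^+ k) (k.+1%:R : R) => c e; ring.
- rewrite !flat_le0// mulr0 subr0.
  have quot : (fun h : R => h^-1 *: ((flat k \o shift 0) (h *: (1 : R)) - flat k 0))
      = flat k.+1.
    apply/funext => h; rewrite /= addr0 (flat_le0 k (lexx 0)) subr0 /GRing.scale/= mulr1.
    by have [h0|h0] := ltP 0 h; [rewrite !flat_gt0// mulrA -exprS|rewrite !flat_le0 ?mulr0].
  have lim : flat k.+1 h @[h --> 0^'] --> (0 : R).
    apply: cvg_within_filter.
    have C0 : k.+2%:R ^+ k.+2 * `|h| @[h --> (0:R)] --> (0 : R).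
      rewrite -[X in _ --> X](mulr0 (k.+2%:R ^+ k.+2)); apply: cvgMr.
      by rewrite -[X in _ --> X](@normr0 R R); apply: cvg_norm; exact: cvg_id.
    apply: (@squeeze_cvgr _ _ _ _ (fun h => - (k.+2%:R ^+ k.+2 * `|h|)) (fun h => k.+2%:R ^+ k.+2 * `|h|)) => //; last first.
      by rewrite -[X in _ --> X]oppr0; apply: cvgN; exact: C0.
    by near=> h; have := flat_bound k h; rewrite ler_norml.
  split; rewrite /derivable /derive quot; first by apply/cvg_ex; exists 0.
  exact: cvg_lim.
Unshelve. all: end_near.
Qed.

End flat.

Section flat_algebra.
Context {R : realType} {n : nat}.
Local Notation E := 'rV[R]_n.

(** An algebra containing the bumps and stable under partial derivatives, so that
iterated derivatives need not be computed. *)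
Inductive flat_alg : (E -> R) -> Prop :=
| flat_alg_flat i c e k : flat_alg (fun x => flat k (c * x ord0 i + e))
| flat_alg_cst a : flat_alg (cst a)
| flat_algD f g : flat_alg f -> flat_alg g -> flat_alg (f + g)
| flat_algM f g : flat_alg f -> flat_alg g -> flat_alg (f * g).

Lemma flat_alg_continuous f : flat_alg f -> continuous f.
Proof.
elim=> [i c e k|a|g h _ cg _ ch|g h _ cg _ ch] x.
- apply: (@continuous_comp _ _ _ (fun x : E => c * x ord0 i + e) (flat k)).
    apply: (@continuousD _ _ _ (fun x : E => c * x ord0 i) (cst e)).
      apply: (@continuousM _ _ (cst c) (fun x : E => x ord0 i)).
        exact: cst_continuous.
      exact: coord_continuous.
    exact: cst_continuous.
  apply: differentiable_continuous; apply/derivable1_diffP.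
  by have [] := is_derive_flat k (c * x ord0 i + e).
- exact: cst_continuous.
- by apply: continuousD; [exact: cg|exact: ch].
- by apply: continuousM; [exact: cg|exact: ch].
Qed.

Lemma flat_alg_derive f j : flat_alg f -> exists2 g, flat_alg g &
  forall x, is_derive x (delta_mx ord0 j : E) f (g x).
Proof.
elim=> [i c e k|a|f1 f2 A1 [g1 B1 D1] A2 [g2 B2 D2]|f1 f2 A1 [g1 B1 D1] A2 [g2 B2 D2]].
- exists (cst ((i == j)%:R * c) *
    ((fun x => flat k.+2 (c * x ord0 i + e)) +
     cst (- k%:R) * (fun x => flat k.+1 (c * x ord0 i + e)))).
    by do ?[apply: flat_algM|apply: flat_algD|exact: flat_alg_cst|exact: flat_alg_flat].
  move=> x; set y := c * x ord0 i + e.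
  pose g (h : R) := flat k (((i == j)%:R * c) * h + y).
  have dg : is_derive (0 : R) (1 : R) g
      (((i == j)%:R * c) * (flat k.+2 y + - k%:R * flat k.+1 y)).
    rewrite mulrC mulNr; apply: is_derive1_comp.
      by rewrite mulr0 add0r; exact: is_derive_flat.
    rewrite (_ : (fun h : R => _) = ((i == j)%:R * c) *: (id : R -> R) + cst y).
      by apply: is_derive_eq; rewrite addr0 /GRing.scale/= mulr1.
    by apply/funext.
  apply: is_derive_slice dg => h; rewrite /g !mxE eqxx/= /y eq_sym; congr flat.
  by rewrite /GRing.scale/=; ring.
- by exists (cst 0); [exact: flat_alg_cst|move=> x; exact: is_derive_cst].
- by exists (g1 + g2); [exact: flat_algD|move=> x; exact: is_deriveD].
- exists (f1 * g2 + f2 * g1); last by move=> x; exact: is_deriveM.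
  by apply: flat_algD; apply: flat_algM.
Qed.

Lemma flat_alg_smooth f : flat_alg f -> smooth f.
Proof.
move=> Af s; have {}Af : flat_alg (foldr partial f s).
  elim: s => //= i s IH; have [g Ag dg] := flat_alg_derive i IH.
  rewrite (_ : partial _ _ = g)//; apply/funext => x.
  by rewrite /partial; have [_ ->] := dg x.
split=> [|i x]; first exact: flat_alg_continuous.
by have [g _ dg] := flat_alg_derive i Af; have [] := dg x.
Qed.

(** Each factor converges to [1] where its argument is positive, because
[flat 0 (m t) = exp (- 1 / (m t))]; hence the product converges to the indicator
of the open box. *)
Definition boxbump (m : nat) (a b x : E) : R :=
  \prod_(i < n) (flat 0 (m.+1%:R * (x ord0 i - a ord0 i)) *
                 flat 0 (m.+1%:R * (b ord0 i - x ord0 i))).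

Lemma flat_alg_boxbump m a b : flat_alg (boxbump m a b).
Proof.
rewrite (_ : boxbump m a b = \prod_(i < n)
    ((fun x : E => flat 0 (m.+1%:R * x ord0 i + - (m.+1%:R * a ord0 i))) *
     (fun x : E => flat 0 (- m.+1%:R * x ord0 i + m.+1%:R * b ord0 i)))).
  elim/big_ind: _ => [|f g|i _]; [exact: flat_alg_cst|exact: flat_algM|].
  by apply: flat_algM; exact: flat_alg_flat.
apply/funext => x; rewrite /boxbump fct_prodE; apply: eq_bigr => i _.
by rewrite mulrfctE; congr (flat _ _ * flat _ _); ring.
Qed.

Lemma flat0_01 (t : R) : 0 <= flat 0 t <= 1.
Proof.
have [t0|t0] := ltP 0 t; last by rewrite flat_le0// lexx ler01.
by rewrite flat_gt0// expr0 mul1r expR_ge0 -expR0 ler_expR oppr_le0 invr_ge0 ltW.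
Qed.

Lemma boxbump_01 m a b x : 0 <= boxbump m a b x <= 1.
Proof.
rewrite /boxbump; elim/big_ind: _ => [|u v /andP[u0 u1] /andP[v0 v1]|i _].
- by rewrite ler01 lexx.
- by rewrite mulr_ge0//= mulr_ile1.
- case/andP: (flat0_01 (m.+1%:R * (x ord0 i - a ord0 i))) => u0 u1.
  case/andP: (flat0_01 (m.+1%:R * (b ord0 i - x ord0 i))) => v0 v1.
  by rewrite mulr_ge0//= mulr_ile1.
Qed.

Lemma boxbump_out m a b x : ~ obox a b x -> boxbump m a b x = 0.
Proof.
move=> /existsNP[i /negP]; rewrite negb_and -!leNgt => abx.
apply/eqP/prodf_eq0; exists i => //; apply/eqP.
case/orP: abx => abx; first by rewrite (flat_le0 _ (x := _ * (x _ _ - _))) ?mul0r// pmulr_rle0// subr_le0.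
by rewrite [X in _ * X]flat_le0 ?mulr0// pmulr_rle0// subr_le0.
Qed.

Lemma cvg_flat0 (t : R) : 0 < t -> flat 0 (m.+1%:R * t) @[m --> \oo] --> (1 : R).
Proof.
move=> t0; rewrite [X in X @ _](_ : _ = (fun m => expR (- (m.+1%:R^-1 * t^-1)))).
  rewrite -[X in _ --> X]expR0; apply: continuous_cvg; first exact: continuous_expR.
  rewrite -oppr0 -[X in - X](mul0r t^-1); apply: cvgN; apply: cvgMl.
  exact: cvg_harmonic.
by apply/funext => m; rewrite flat_gt0 ?mulr_gt0// expr0 mul1r invfM.
Qed.

Lemma cvg_boxbump a b x :
  boxbump m a b x @[m --> \oo] --> (\1_(obox a b) x : R).
Proof.
rewrite indicE; have [|/negP] := boolP (x \in _); rewrite inE => abx; last first.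
  by under eq_fun do rewrite boxbump_out//; exact: cvg_cst.
rewrite [X in _ --> X](_ : _ = \prod_(i < n) (1 * 1)); last first.
  by rewrite mulr1 big1_eq.
apply: (@cvg_big R _ *%R 1 _ (@mul_continuous R)) => i _; apply: cvgM.
  by apply: cvg_flat0; have /andP[] := abx i; rewrite subr_gt0.
by apply: cvg_flat0; have /andP[] := abx i; rewrite subr_gt0.
Qed.

Lemma test_boxbump (Om : set E) m a b : cbox a b `<=` Om -> test_fun Om (boxbump m a b).
Proof.
move=> abO.
have sub : supp (boxbump m a b) `<=` cbox a b.
  rewrite /supp (closure_id (cbox a b)).1; last exact: closed_cbox.
  apply: closure_subset => x /= /eqP bx; apply: obox_sub_cbox.
  by apply: contrapT => /(boxbump_out m).
split; [exact/flat_alg_smooth/flat_alg_boxbump| |exact: subset_trans sub abO].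
by apply: (subclosed_compact _ (@compact_cbox _ _ a b)) => //; exact: closed_closure.
Qed.

End flat_algebra.

(** * The fundamental lemma of the calculus of variations *)

Section generation.
Context {R : realType} {n : nat}.
Local Notation E := 'rV[R]_n.

Definition oboxes : set (set E) := [set A | exists a b, A = obox a b].

Lemma obox_setI (a b a' b' : E) : obox a b `&` obox a' b' =
  obox (\row_i Num.max (a ord0 i) (a' ord0 i)) (\row_i Num.min (b ord0 i) (b' ord0 i)).
Proof.
apply/seteqP; split => [x [xab xab'] i|x xab].
  have /andP[? ?] := xab i; have /andP[? ?] := xab' i.
  by rewrite !mxE gt_max lt_min; apply/andP; split; apply/andP.
by split=> i; have := xab i; rewrite !mxE gt_max lt_min => /andP[/andP[? ?] /andP[? ?]];
  apply/andP.
Qed.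

Lemma oboxes_setI_closed : setI_closed oboxes.
Proof. by move=> _ _ [a [b ->]] [a' [b' ->]]; rewrite obox_setI; do 2 eexists. Qed.

Lemma measurable_oboxes : @measurable _ E = <<s oboxes >>.
Proof.
apply/seteqP; split; last first.
  apply: smallest_sub; first exact: sigma_algebra_measurable.
  by move=> _ [a [b ->]]; exact: measurable_obox.
apply: smallest_sub; first exact: smallest_sigma_algebra.
move=> A; rewrite -bigcup_seq/= => -[i _] [Y mY <-].
have : measurable_fun setT (rV_coord i : g_sigma_algebraType oboxes -> measurableTypeR R).
  apply: (measurability _ (RGenOpens.measurableE R)).
  move=> _ [_ [a [b ->] <-]]; rewrite setTI.
  have -> : rV_coord i @^-1` `]a, b[%classic =
      \bigcup_k obox (\row_j (if j == i then a else - k%:R) : E)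
                     (\row_j (if j == i then b else k%:R)).
    apply/seteqP; split => x /=; rewrite in_itv/=.
      move=> xab.
      have [k xk] : exists k : nat, forall j, `|x ord0 j| < k%:R.
        exists (Num.bound (\sum_j `|x ord0 j|)) => j.
        apply: le_lt_trans (archi_boundP _); last by apply: sumr_ge0.
        by rewrite (bigD1 j)//= lerDl sumr_ge0.
      exists k => // j; rewrite !mxE; case: eqP => [->//|_].
      by rewrite -ltr_norml.
    by move=> [k _ /(_ i)]; rewrite !mxE eqxx.
  apply: bigcupT_measurable => k; apply: sub_sigma_algebra.
  by do 2 eexists.
by move=> /(_ measurableT Y mY).
Qed.

End generation.

Section fundamental.
Context {R : realType} {d : nat} (Om : set 'rV[R]_d).
Hypotheses (oOm : open Om) (bOm : bounded_set Om).
Local Notation E := 'rV[R]_d.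
Local Notation mu := (lebesgue_rV d : {measure set E -> \bar R}).

Lemma measurable_domain : measurable Om.
Proof. exact: open_measurable_rV. Qed.
Let mOm := measurable_domain.

Lemma domain_lty : (mu Om < +oo)%E.
Proof. exact: bounded_lty. Qed.

(** Dominated convergence along the bumps of the box, with bound [|g|]. *)
Lemma integral_obox_eq0 (g : E -> R) a b :
  mu.-integrable Om (EFin \o g) ->
  (forall phi, test_fun Om phi -> \int[mu]_(x in Om) (g x * phi x) = 0) ->
  cbox a b `<=` Om -> (\int[mu]_(x in obox a b) (g x)%:E = 0)%E.
Proof.
move=> ig g0 abO.
have mg : measurable_fun Om g by apply/measurable_EFinP; exact: measurable_int ig.
have mbump m : measurable_fun Om (boxbump m a b : E -> measurableTypeR R).
  by apply: continuous_measurable_rV => //; exact/flat_alg_continuous/flat_alg_boxbump.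
have mmul m : measurable_fun Om (fun x => g x * boxbump m a b x).
  by apply: measurable_funM => //; exact: mbump.
have abs_le m x : (`|(g x * boxbump m a b x)%:E| <= `|(g x)%:E|)%E.
  rewrite lee_fin normrM ler_piMr//; have /andP[b0 b1] := boxbump_01 m a b x.
  by rewrite ger0_norm.
have [] := @dominated_convergence _ _ _ mu Om mOm
  (fun m x => (g x * boxbump m a b x)%:E) (fun x => (g x * \1_(obox a b) x)%:E)
  (fun x => `|(g x)%:E|)%E.
- by move=> m; exact/measurable_EFinP.
- apply/measurable_EFinP; apply: measurable_funM => //.
  by apply: measurable_indic; exact: measurable_obox.
- apply: aeW => x _; apply: cvg_EFin; first exact: nearW.
  by apply: cvgMr; exact: cvg_boxbump.
- exact: integrable_abse.
- by apply: aeW => x m _; exact: abs_le.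
move=> _ _ cv.
have {cv} : (\int[mu]_(x in Om) (g x * \1_(obox a b) x)%:E = 0)%E.
  apply: cvg_unique cv _; first exact: ereal_hausdorff.
  rewrite (_ : [sequence _]_n = cst 0%E); first exact: cvg_cst.
  apply/funext => m /=.
  have im : mu.-integrable Om (fun x => (g x * boxbump m a b x)%:E).
    apply: le_integrable ig => //; first exact/measurable_EFinP.
  rewrite -(fineK (integrable_fin_num mOm im)); congr EFin.
  by apply: g0; exact: test_boxbump.
move=> <-; rewrite [in LHS](_ : obox a b = Om `&` obox a b); last first.
  by rewrite setIidr//; move=> x /obox_sub_cbox; exact: abO.
rewrite integral_mkcondr; apply: eq_integral => x _.
by rewrite patchE indicE; case: ifPn => _; rewrite ?mulr1 ?mulr0.
Qed.

(** On a box [B] whose closure lies in [Om], the sets [A] with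
[int_(A inter B) g = 0] form a lambda-system containing the open boxes, hence
contain all Borel sets; so [g = 0] a.e. on [B], and countably many such [B] cover
[Om]. *)
Lemma test_orthogonal_eq0 (g : E -> R) :
  mu.-integrable Om (EFin \o g) ->
  (forall phi, test_fun Om phi -> \int[mu]_(x in Om) (g x * phi x) = 0) ->
  g = (fun=> 0) %[ae mu in Om].
Proof.
move=> ig g0.
have box0 k : rat_cbox k `<=` Om ->
    ae_eq mu (rat_obox k) (EFin \o g) (cst 0%E).
  move=> kO; set B := rat_obox k.
  have BO : B `<=` Om by move=> x /obox_sub_cbox; exact: kO.
  have mB : measurable B by exact: measurable_obox.
  have iB A : measurable A -> A `<=` B -> mu.-integrable A (EFin \o g).
    by move=> mA AB; apply: integrableS ig => //; exact: subset_trans BO.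
  have B0 : (\int[mu]_(x in B) (g x)%:E = 0)%E by exact: integral_obox_eq0.
  have P0 A : measurable A -> (\int[mu]_(x in A `&` B) (g x)%:E = 0)%E.
    move=> mA; move: (mA); rewrite measurable_oboxes.
    move: A {mA}; apply: dynkin_induction; rewrite -?measurable_oboxes//.
    - exact: oboxes_setI_closed.
    - by rewrite setTI.
    - move=> _ [a [b ->]]; rewrite /B /rat_obox obox_setI.
      apply: integral_obox_eq0 => //; apply: subset_trans kO => x xab i.
      by have := xab i; rewrite !mxE ge_max le_min => /andP[/andP[_ ->] /andP[_ ->]].
    - move=> S mS S0.
      have mSB := measurableI _ _ mS mB; have mCB := measurableI _ _ (measurableC mS) mB.
      have BE : B = (S `&` B) `|` (~` S `&` B) by rewrite -setIUl setUv setTI.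
      move: B0; rewrite {1}BE integral_setU//.
      + by rewrite S0 add0e.
      + by rewrite -BE; apply: measurable_int (iB B mB _).
      + by apply/disj_setPS => x [[Sx _] [nSx _]]; exact: nSx.
    - move=> F mF tF F0; rewrite setI_bigcupl integral_bigcup.
      + by rewrite eseries0.
      + exact: trivIset_setIr.
      + by move=> i; exact: measurableI.
      + apply: iB; last by move=> x [i _ []].
        by apply: bigcupT_measurable => i; exact: measurableI.
  apply: integral_ae_eq => //; first exact: iB.
  move=> A AB mA; rewrite integral0 -(P0 A mA) setIidl//.
have : mu.-negligible (\bigcup_(k in [set k | rat_cbox k `<=` Om])
    (rat_obox k `&` [set x | g x != 0])).
  rewrite bigcup_mkcond; apply: negligible_bigcup => k; case: ifPn => [|_].
    rewrite inE => /box0; apply: negligibleS => x [kx /= gx] ae0.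
    by move/eqP: gx; apply; apply: EFin_inj; exact: ae0.
  exact: negligible_set0.
apply: negligibleS => x /= /not_implyP[Ox /eqP gx].
have [k kO kx] : (\bigcup_(k in [set k | rat_cbox k `<=` Om]) rat_obox k) x.
  by rewrite -open_bigcup_rat_obox.
by exists k.
Qed.

End fundamental.

(** * The inner product of [L2] *)

(** The Cauchy-Schwarz inequality for any semidefinite form, scalar or matrix
valued; [c] may vanish, in which case the line [a + 2 t b] must be constant. *)
Lemma discriminant_bound {R : realType} (a b c : R) : 0 <= a -> 0 <= c ->
  (forall t, 0 <= a + 2 * t * b + t ^+ 2 * c) -> `|b| <= Num.sqrt a * Num.sqrt c.
Proof.
move=> a0 c0 H; rewrite -sqrtrM// -sqrtr_sqr ler_wsqrtr//.
have [ce|cn] := eqVneq c 0.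
  move: H; rewrite ce => H; rewrite mulr0.
  suff -> : b = 0 by rewrite expr0n.
  apply/eqP; apply: contraT => bn.
  have := H (- (a + 1) / (2 * b)); rewrite mulr0 addr0.
  rewrite (_ : 2 * _ * b = - (a + 1)); last by field.
  lra.
have c1 : 0 < c by rewrite lt_def cn.
have := H (- b / c); rewrite (_ : _ + _ = a - b ^+ 2 / c); last by field.
by rewrite subr_ge0 ler_pdivrMr.
Qed.

Section L2_theory.
Context {R : realType} {d : nat} (Om : set 'rV[R]_d).
Hypotheses (oOm : open Om) (bOm : bounded_set Om).
Local Notation E := 'rV[R]_d.
Local Notation mu := (lebesgue_rV d : {measure set E -> \bar R}).
Local Notation L2 := (L2 Om).
Local Notation ip := (ip Om).
Local Notation l2norm := (l2norm Om).
Implicit Types f g h : E -> R.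
Let mOm : measurable Om := measurable_domain oOm.

Lemma L2_measurable f : L2 f -> measurable_fun Om f.
Proof. by case. Qed.

Lemma L2_mul_integrable f g : L2 f -> L2 g ->
  mu.-integrable Om (fun x => (f x * g x)%:E).
Proof.
move=> [mf f2] [mg g2].
apply: (@le_integrable _ _ _ _ _ mOm _ (fun x => (f x ^+ 2)%:E + (g x ^+ 2)%:E)%E).
- by apply/measurable_EFinP; exact: measurable_funM.
- move=> x _; rewrite -EFinD lee_fin normrM [leRHS]ger0_norm ?addr_ge0 ?sqr_ge0//.
  rewrite -(real_normK (num_real (f x))) -(real_normK (num_real (g x))).
  have := sqr_ge0 (`|f x| - `|g x|); have := mulr_ge0 (normr_ge0 (f x)) (normr_ge0 (g x)).
  by nra.
- exact: integrableD.
Qed.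

Lemma L2_cst (c : R) : L2 (fun=> c).
Proof.
split; first exact: measurable_cst.
apply: measurable_bounded_integrable => //; first exact: domain_lty.
by exists (`|c ^+ 2|); split => // y cy x _; exact: ltW.
Qed.

Lemma L2_integrable f : L2 f -> mu.-integrable Om (EFin \o f).
Proof.
move=> Lf; apply: eq_integrable (L2_mul_integrable Lf (L2_cst 1)) => // x _.
by rewrite mulr1.
Qed.

Lemma L2D f g : L2 f -> L2 g -> L2 (fun x => f x + g x).
Proof.
move=> Lf Lg; have [mf f2] := Lf; have [mg g2] := Lg.
split; first exact: measurable_funD.
have fg := L2_mul_integrable Lf Lg.
apply: (@eq_integrable _ _ _ _ _ mOm
    (fun x => ((f x) ^+ 2)%:E + ((f x * g x)%:E + ((f x * g x)%:E + (g x ^+ 2)%:E)))%E).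
  by move=> x _ /=; rewrite -!EFinD; congr EFin; ring.
by do ?apply: integrableD.
Qed.

Lemma L2Z a f : L2 f -> L2 (fun x => a * f x).
Proof.
move=> [mf f2]; split; first by apply: measurable_funM => //; exact: measurable_cst.
apply: (@eq_integrable _ _ _ _ _ mOm (fun x => (a ^+ 2)%:E * ((f x) ^+ 2)%:E)%E).
  by move=> x _ /=; rewrite -EFinM; congr EFin; ring.
exact: integrableZl.
Qed.

Lemma L2N f : L2 f -> L2 (fun x => - f x).
Proof. by move=> /(L2Z (-1)); under eq_fun do rewrite mulN1r. Qed.

Lemma L2B f g : L2 f -> L2 g -> L2 (fun x => f x - g x).
Proof. by move=> Lf /L2N; exact: L2D. Qed.

Lemma L2_sum (I : Type) (r : seq I) (F : I -> E -> R) :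
  (forall i, L2 (F i)) -> L2 (fun x => \sum_(i <- r) F i x).
Proof.
move=> LF; elim: r => [|i r IH].
  by under eq_fun do rewrite big_nil; exact: L2_cst.
by under eq_fun do rewrite big_cons; exact: L2D.
Qed.

Lemma ipC f g : ip f g = ip g f.
Proof. by apply: eq_Rintegral => x _; rewrite mulrC. Qed.

Lemma ipDl f g h : L2 f -> L2 g -> L2 h ->
  ip (fun x => f x + g x) h = ip f h + ip g h.
Proof.
move=> Lf Lg Lh; rewrite -RintegralD//; try exact: L2_mul_integrable.
by apply: eq_Rintegral => x _; rewrite mulrDl.
Qed.

Lemma ipZl a f h : L2 f -> L2 h -> ip (fun x => a * f x) h = a * ip f h.
Proof.
move=> Lf Lh; rewrite -RintegralZl//; last exact: L2_mul_integrable.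
by apply: eq_Rintegral => x _; rewrite mulrA.
Qed.

Lemma ipNl f h : L2 f -> L2 h -> ip (fun x => - f x) h = - ip f h.
Proof.
by move=> Lf Lh; rewrite -mulN1r -ipZl//; under eq_fun do rewrite -mulN1r.
Qed.

Lemma ipBl f g h : L2 f -> L2 g -> L2 h ->
  ip (fun x => f x - g x) h = ip f h - ip g h.
Proof. by move=> Lf Lg Lh; rewrite ipDl ?ipNl//; exact: L2N. Qed.

Lemma ipDr f g h : L2 f -> L2 g -> L2 h ->
  ip h (fun x => f x + g x) = ip h f + ip h g.
Proof. by move=> Lf Lg Lh; rewrite ipC ipDl// ipC (ipC g). Qed.

Lemma ipZr a f h : L2 f -> L2 h -> ip h (fun x => a * f x) = a * ip h f.
Proof. by move=> Lf Lh; rewrite ipC ipZl// ipC. Qed.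

Lemma ipNr f h : L2 f -> L2 h -> ip h (fun x => - f x) = - ip h f.
Proof. by move=> Lf Lh; rewrite ipC ipNl// ipC. Qed.

Lemma ipBr f g h : L2 f -> L2 g -> L2 h ->
  ip h (fun x => f x - g x) = ip h f - ip h g.
Proof. by move=> Lf Lg Lh; rewrite ipC ipBl// ipC (ipC g). Qed.

Lemma ip_ge0 f : 0 <= ip f f.
Proof. by apply: Rintegral_ge0 => x _; rewrite -expr2 sqr_ge0. Qed.

Lemma l2norm_sqr f : l2norm f ^+ 2 = ip f f.
Proof. by rewrite sqr_sqrtr// ip_ge0. Qed.

Lemma l2norm_ge0 f : 0 <= l2norm f.
Proof. exact: sqrtr_ge0. Qed.

Lemma l2normN f : L2 f -> l2norm (fun x => - f x) = l2norm f.
Proof.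
by move=> Lf; rewrite /Defs.l2norm ipNl ?ipNr ?opprK//; exact: L2N.
Qed.

Lemma cauchy_schwarz f g : L2 f -> L2 g -> `|ip f g| <= l2norm f * l2norm g.
Proof.
move=> Lf Lg; apply: discriminant_bound; try exact: ip_ge0.
move=> t; have := ip_ge0 (fun x => f x + t * g x).
have Ltg := L2Z t Lg; have Lh := L2D Lf Ltg.
by rewrite ipDl ?ipZl ?ipDr ?ipZr// (ipC g f); lra.
Qed.

Lemma l2norm_triangle f g : L2 f -> L2 g ->
  l2norm (fun x => f x + g x) <= l2norm f + l2norm g.
Proof.
move=> Lf Lg; rewrite -(ler_pXn2r (n := 2))// ?nnegrE ?addr_ge0 ?l2norm_ge0//.
have Lh := L2D Lf Lg; rewrite l2norm_sqr ipDl ?ipDr// -!l2norm_sqr (ipC g f).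
by have := ler_normlW (cauchy_schwarz Lf Lg); nra.
Qed.

Lemma ip_ae f f' g : L2 f -> L2 f' -> L2 g ->
  f = f' %[ae mu in Om] -> ip f g = ip f' g.
Proof.
move=> Lf Lf' Lg ff'; rewrite /Defs.ip /Rintegral; congr fine.
apply: ae_eq_integral => //.
- by apply/measurable_EFinP; apply: measurable_funM; exact: L2_measurable.
- by apply/measurable_EFinP; apply: measurable_funM; exact: L2_measurable.
- by apply: filterS ff' => x /= fx Ox; rewrite fx.
Qed.

Lemma ip_ae0 f g : L2 f -> L2 g -> f = (fun=> 0) %[ae mu in Om] -> ip f g = 0.
Proof.
move=> Lf Lg f0; rewrite (ip_ae Lf (L2_cst 0) Lg f0).
by have := ipZl 0 (L2_cst 0) Lg; rewrite !mul0r.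
Qed.

Lemma l2norm_ae f f' : L2 f -> L2 f' -> f = f' %[ae mu in Om] ->
  l2norm f = l2norm f'.
Proof.
move=> Lf Lf' ff'; rewrite /Defs.l2norm (ip_ae Lf Lf' Lf ff') ipC.
by rewrite (ip_ae Lf Lf' Lf' ff').
Qed.

Lemma ip_eq0_ae f : L2 f -> ip f f = 0 -> f = (fun=> 0) %[ae mu in Om].
Proof.
move=> Lf f0; have i2 := L2_mul_integrable Lf Lf.
have : (\int[mu]_(x in Om) `|(f x * f x)%:E| = 0)%E.
  under eq_integral do rewrite gee0_abs ?lee_fin -?expr2 ?sqr_ge0//.
  rewrite -[LHS]fineK; first by congr EFin; exact: f0.
  exact: integrable_fin_num.
move=> /(ae_eq_integral_abs mu mOm (measurable_int _ i2)).1.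
apply: filterS => x /= ffx Ox; have /eqP := ffx Ox.
by rewrite eqe mulf_eq0 orbb => /eqP.
Qed.

Lemma l2norm_eq0_ae f : L2 f -> l2norm f = 0 -> f = (fun=> 0) %[ae mu in Om].
Proof.
by move=> Lf n0; apply: ip_eq0_ae => //; rewrite -l2norm_sqr n0 expr0n.
Qed.

End L2_theory.

(** * Test functions *)

Section test_functions.
Context {R : realType} {d : nat} (Om : set 'rV[R]_d).
Hypotheses (oOm : open Om) (bOm : bounded_set Om).
Local Notation E := 'rV[R]_d.
Local Notation mu := (lebesgue_rV d : {measure set E -> \bar R}).
Local Notation L2 := (L2 Om).
Local Notation ip := (ip Om).
Local Notation l2norm := (l2norm Om).
Implicit Types f g h phi psi : E -> R.
Let mOm : measurable Om := measurable_domain oOm.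

(** Functions vanishing outside [Om] are integrated over the whole space, where
boundedness of [Om] makes them compactly supported. *)
Lemma integral_domain_partial_eq0 i f g : continuous g ->
  (forall x, is_derive x (delta_mx ord0 i : E) f (g x)) ->
  (forall x, ~ Om x -> f x = 0) -> (forall x, ~ Om x -> g x = 0) ->
  \int[mu]_(x in Om) g x = 0.
Proof.
move=> cg fg f0 g0; have [M M0 OM] := bounded_sub_cube bOm.
rewrite Rintegral_mkcond (_ : g \_ Om = g).
  rewrite /Rintegral (@integral_partial_eq0 _ _ f g i M)//.
    by move=> x xM; apply: f0 => /OM.
  by move=> x xM; apply: g0 => /OM.
by apply/funext => x; rewrite patchE; case: ifPn => //; rewrite notin_setE => /g0.
Qed.

Lemma test_out phi x : test_fun Om phi -> ~ Om x -> phi x = 0.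
Proof.
move=> [_ _ sO] nO; apply/eqP; apply: contra_notT nO => px.
by apply: sO; exact: subset_closure.
Qed.

Lemma test_continuous phi : test_fun Om phi -> continuous phi.
Proof. by move=> [/(_ [::])[]]. Qed.

Lemma test_partial_continuous i phi : test_fun Om phi -> continuous (partial i phi).
Proof. by move=> [/(_ [:: i])[]]. Qed.

Lemma test_is_derive i phi x : test_fun Om phi ->
  is_derive x (delta_mx ord0 i : E) phi (partial i phi x).
Proof. by move=> [/(_ [::])[_ dphi] _ _]; split => //; exact: dphi. Qed.

Lemma test_partial_out i phi x : test_fun Om phi -> ~ Om x -> partial i phi x = 0.
Proof.
move=> [_ _ sO] nO; have nsx : (~` supp phi) x by move=> /sO.
rewrite /partial (@near_eq_derive _ _ _ phi (cst 0)); first exact: derive_cst.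
have : nbhs x (~` supp phi) by apply: open_nbhs_nbhs; split => //;
  apply: closed_openC; exact: closed_closure.
apply: filterS => y ny; apply/eqP; apply: contra_notT ny => py.
exact: subset_closure.
Qed.

Lemma continuous_L2 f : continuous f -> (forall x, ~ Om x -> f x = 0) -> L2 f.
Proof.
move=> cf f0; split; first exact: continuous_measurable_rV.
have [M _ OM] := bounded_sub_cube bOm.
apply: (@integrableS _ _ _ _ setT) => //.
apply: (@continuous_integrable _ _ (fun x => f x ^+ 2) M).
  by move=> x; apply: (@continuousM _ _ f f); exact: cf.
by move=> x xM; rewrite f0 ?expr0n// => /OM.
Qed.

Lemma test_L2 phi : test_fun Om phi -> L2 phi.
Proof.
move=> tp; apply: continuous_L2; first exact: test_continuous.
by move=> x; exact: test_out.
Qed.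

Lemma test_partial_L2 i phi : test_fun Om phi -> L2 (partial i phi).
Proof.
move=> tp; apply: continuous_L2; first exact: test_partial_continuous.
by move=> x; exact: test_partial_out.
Qed.

Lemma test_integral_partial i phi : test_fun Om phi ->
  \int[mu]_(x in Om) partial i phi x = 0.
Proof.
move=> tp; apply: (@integral_domain_partial_eq0 i phi).
- exact: test_partial_continuous.
- by move=> x; exact: test_is_derive.
- by move=> x; exact: test_out.
- by move=> x; exact: test_partial_out.
Qed.

Lemma test_ibp i phi psi : test_fun Om phi -> test_fun Om psi ->
  ip phi (partial i psi) = - ip (partial i phi) psi.
Proof.
move=> tp tq; apply/eqP; rewrite -addr_eq0; apply/eqP.
rewrite -RintegralD//; try by apply: L2_mul_integrable => //;
  (exact: test_L2 || exact: test_partial_L2).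
apply: (@integral_domain_partial_eq0 i (phi * psi)).
- move=> x; apply: (@continuousD _ _ _ (phi * partial i psi) (partial i phi * psi)).
    by apply: continuousM; [exact: test_continuous|exact: test_partial_continuous].
  by apply: continuousM; [exact: test_partial_continuous|exact: test_continuous].
- move=> x; apply: is_derive_eq.
    by apply: is_deriveM; exact: test_is_derive.
  by rewrite /GRing.scale/= [psi x * _]mulrC.
- by move=> x nO; rewrite /= mulrfctE (test_out tp nO) mul0r.
- by move=> x nO; rewrite (test_out tp nO) (test_out tq nO) mul0r mulr0 addr0.
Qed.

(** Integrate the derivative of [x_i phi ^ 2] and use [|x_i| <= M] on [Om]. *)
Lemma test_poincare i phi (M : R) : test_fun Om phi -> 0 < M -> Om `<=` cube d M ->
  l2norm phi <= 2 * M * l2norm (partial i phi).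
Proof.
move=> tp M0 OM.
have cx : continuous (fun x : E => x ord0 i) by exact: coord_continuous.
have Lp := test_L2 tp; have Lq := test_partial_L2 i tp.
have Lxp : L2 (fun x => x ord0 i * phi x).
  apply: continuous_L2 => [x|x nO]; last by rewrite (test_out tp nO) mulr0.
  by apply: continuousM; [exact: cx|exact: test_continuous].
have ibp : ip phi phi = - (2 * ip (fun x => x ord0 i * phi x) (partial i phi)).
  have L2xp := L2Z oOm 2 Lxp.
  rewrite -(ipZl oOm)//.
  apply/eqP; rewrite -addr_eq0; apply/eqP.
  rewrite -RintegralD//; try exact: L2_mul_integrable.
  apply: (@integral_domain_partial_eq0 i ((fun x : E => x ord0 i) * (phi * phi))).
  - move=> x; apply: (@continuousD _ _ _ (phi * phi)
      ((fun y : E => 2 * (y ord0 i * phi y)) * partial i phi)).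
      by apply: continuousM; exact: test_continuous.
    apply: continuousM; last exact: test_partial_continuous.
    apply: (@continuousM _ _ (cst 2) (fun y : E => y ord0 i * phi y)).
      exact: cst_continuous.
    by apply: continuousM; [exact: cx|exact: test_continuous].
  - move=> x; have dx : is_derive x (delta_mx ord0 i : E) (fun x : E => x ord0 i) 1.
      have dl : is_derive (0 : R) (1 : R) (fun h : R => h + x ord0 i) 1.
        rewrite (_ : (fun h : R => _) = (id : R -> R) + cst (x ord0 i)).
          by apply: is_derive_eq; rewrite addr0.
        by apply/funext.
      apply: is_derive_slice dl => h.
      by rewrite !mxE !eqxx mulr1 /GRing.scale/= mulr1 addr0.
    have dp := test_is_derive i x tp.
    apply: is_derive_eq; rewrite /GRing.scale/=.
    by change ((phi * phi) x) with (phi x * phi x); ring.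
  - by move=> x nO; rewrite /= !mulrfctE (test_out tp nO) !mulr0.
  - by move=> x nO; rewrite (test_out tp nO) mul0r mulr0 mulr0 mul0r addr0.
have xp_le : l2norm (fun x => x ord0 i * phi x) <= M * l2norm phi.
  rewrite -(ler_pXn2r (n := 2))// ?nnegrE ?mulr_ge0 ?l2norm_ge0 ?(ltW M0)//.
  rewrite exprMn !l2norm_sqr -RintegralZl//; last exact: L2_mul_integrable.
  apply: le_Rintegral => //; first exact: L2_mul_integrable.
    apply: (@eq_integrable _ _ _ _ _ mOm
      (fun x => (M ^+ 2)%:E * (phi x * phi x)%:E)%E) => //.
    by apply: integrableZl => //; exact: L2_mul_integrable.
  move=> x /OM /cubeE /(_ i) xM.
  rewrite (_ : _ * _ = (x ord0 i) ^+ 2 * (phi x * phi x)); last by ring.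
  rewrite ler_wpM2r// -?expr2 ?sqr_ge0// -(real_normK (num_real (x ord0 i))).
  by rewrite lerXn2r// nnegrE ltW.
have := cauchy_schwarz oOm Lxp Lq.
have n0 := l2norm_ge0 Om phi; have n1 := l2norm_ge0 Om (partial i phi).
move=> /ler_normlP[cs _].
have sq : l2norm phi ^+ 2 <= 2 * M * l2norm (partial i phi) * l2norm phi.
  rewrite l2norm_sqr ibp; move: cs xp_le n0 n1.
  move: (ip _ _) (l2norm _) (l2norm phi) (l2norm (partial _ _)) => a b c e.
  by nra.
have [->|] := eqVneq (l2norm phi) 0; first by rewrite mulr_ge0// mulr_ge0// ltW.
by move=> nz; move: sq; rewrite expr2 ler_pM2r// lt_def nz.
Qed.

End test_functions.

(** * Weak gradients and [H10] *)

Section sobolev.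
Context {R : realType} {d : nat} (Om : set 'rV[R]_d).
Hypotheses (oOm : open Om) (bOm : bounded_set Om).
Local Notation E := 'rV[R]_d.
Local Notation mu := (lebesgue_rV d : {measure set E -> \bar R}).
Local Notation L2 := (L2 Om).
Local Notation H1 := (H1 Om).
Local Notation H10 := (H10 Om).
Local Notation ip := (ip Om).
Local Notation l2norm := (l2norm Om).
Implicit Types f g h phi psi : E -> R.
Let mOm : measurable Om := measurable_domain oOm.

Definition pgrad (i : 'I_d) f : E -> R := fun x => grad Om f x ord0 i.

Lemma gradP f : H1 f -> weak_grad Om f (grad Om f).
Proof. by move=> [_ wf]; exact: xgetPex. Qed.

Lemma H1_L2 f : H1 f -> L2 f. Proof. by case. Qed.

Lemma pgrad_L2 i f : H1 f -> L2 (pgrad i f).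
Proof. by move=> /gradP[Lg _]; exact: Lg. Qed.

(** Stated for a.e. equal functions so that it also shows that [pgrad] does not
depend on the representative. *)
Lemma weak_grad_unique f f' (G G' : E -> 'rV[R]_d) i : L2 f -> L2 f' ->
  f = f' %[ae mu in Om] -> weak_grad Om f G -> weak_grad Om f' G' ->
  (fun x => G x ord0 i) = (fun x => G' x ord0 i) %[ae mu in Om].
Proof.
move=> Lf Lf' ff' [LG ibpG] [LG' ibpG'].
have LB := L2B oOm (LG i) (LG' i).
have : (fun x => G x ord0 i - G' x ord0 i) = (fun=> 0) %[ae mu in Om].
  apply: test_orthogonal_eq0 => //; first exact: L2_integrable.
  move=> phi tp; have Lp := test_L2 oOm bOm tp.
  have Lq := test_partial_L2 oOm bOm i tp.
  rewrite -/(Defs.ip Om (fun x => G x ord0 i - G' x ord0 i) phi) ipBl//.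
  have := ibpG i phi tp; rewrite (ip_ae oOm Lf Lf' Lq ff') (ibpG' i phi tp).
  by move=> /oppr_inj ->; rewrite subrr.
by apply: filterS => x /= GG Ox; apply/eqP; rewrite -subr_eq0 GG.
Qed.

Lemma weak_grad_lin a f g (G G' : E -> 'rV[R]_d) : L2 f -> L2 g ->
  weak_grad Om f G -> weak_grad Om g G' ->
  weak_grad Om (fun x => a * f x + g x) (fun x => a *: G x + G' x).
Proof.
move=> Lf Lg [LG ibpG] [LG' ibpG'].
have cE i : (fun x => (a *: G x + G' x) ord0 i) =
            (fun x => a * G x ord0 i + G' x ord0 i).
  by apply/funext => x; rewrite !mxE.
split=> [i|i phi tp]; rewrite cE.
  by apply: L2D => //; exact: L2Z.
have Lp := test_L2 oOm bOm tp; have Lq := test_partial_L2 oOm bOm i tp.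
have LaG := L2Z oOm a (LG i); have Laf := L2Z oOm a Lf.
by rewrite !(ipDl oOm)// !(ipZl oOm)// ibpG// ibpG'// opprD mulrN.
Qed.

Lemma H1_lin a f g : H1 f -> H1 g -> H1 (fun x => a * f x + g x).
Proof.
move=> Hf Hg; have [Lf Lg] := (H1_L2 Hf, H1_L2 Hg); split.
  by apply: L2D => //; exact: L2Z.
exists (fun x => a *: grad Om f x + grad Om g x).
by apply: weak_grad_lin => //; exact: gradP.
Qed.

Lemma pgrad_lin i a f g : H1 f -> H1 g ->
  pgrad i (fun x => a * f x + g x) =
  (fun x => a * pgrad i f x + pgrad i g x) %[ae mu in Om].
Proof.
move=> Hf Hg; have Hl := H1_lin a Hf Hg.
have := weak_grad_unique i (H1_L2 Hl) (H1_L2 Hl) (@ae_eq_refl _ _ _ _ _ _ _) (gradP Hl)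
  (weak_grad_lin a (H1_L2 Hf) (H1_L2 Hg) (gradP Hf) (gradP Hg)).
by apply: filterS => x /= xE Ox; rewrite [LHS]xE// !mxE.
Qed.

Lemma weak_grad0 : weak_grad Om (fun=> 0) (fun=> 0).
Proof.
split=> [i|i phi tp].
  by under eq_fun do rewrite mxE; exact: L2_cst.
rewrite [LHS](_ : _ = 0) ?[X in - X](_ : _ = 0) ?oppr0//.
  by rewrite /Defs.ip; under eq_Rintegral do rewrite mxE mul0r;
    rewrite Rintegral_cst// mul0r.
by rewrite /Defs.ip; under eq_Rintegral do rewrite mul0r; rewrite Rintegral_cst// mul0r.
Qed.

Lemma H1_0 : H1 (fun=> 0).
Proof. by split; [exact: L2_cst|exists (fun=> 0); exact: weak_grad0]. Qed.

Lemma pgrad_ae0 i f : H1 f -> f = (fun=> 0) %[ae mu in Om] ->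
  pgrad i f = (fun=> 0) %[ae mu in Om].
Proof.
move=> Hf f0.
have := weak_grad_unique i (H1_L2 Hf) (L2_cst oOm bOm 0) f0 (gradP Hf) weak_grad0.
by apply: filterS => x /= xE Ox; rewrite [LHS]xE// mxE.
Qed.

Lemma weak_grad_test phi : test_fun Om phi ->
  weak_grad Om phi (fun x => \row_i partial i phi x).
Proof.
move=> tp; have cE i : (fun x => (\row_j partial j phi x) ord0 i) = partial i phi.
  by apply/funext => x; rewrite mxE.
split=> [i|i psi tq]; rewrite cE; first exact: test_partial_L2.
exact: test_ibp.
Qed.

Lemma test_H1 phi : test_fun Om phi -> H1 phi.
Proof.
by move=> tp; split; [exact: test_L2|eexists; exact: weak_grad_test].
Qed.

Lemma pgrad_test i phi : test_fun Om phi ->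
  pgrad i phi = partial i phi %[ae mu in Om].
Proof.
move=> tp; have Hp := test_H1 tp.
have := weak_grad_unique i (H1_L2 Hp) (H1_L2 Hp) (@ae_eq_refl _ _ _ _ _ _ _) (gradP Hp)
  (weak_grad_test tp).
by apply: filterS => x /= xE Ox; rewrite [LHS]xE// mxE.
Qed.

Lemma ipmxE m n (F G : E -> 'M[R]_(m, n)) :
  (forall i j, L2 (fun x => F x i j)) -> (forall i j, L2 (fun x => G x i j)) ->
  ipmx Om F G = \sum_i \sum_j ip (fun x => F x i j) (fun x => G x i j).
Proof.
move=> LF LG; rewrite /ipmx.
have sumE (I : Type) (r : seq I) (h : I -> E -> R) :
    (forall k, mu.-integrable Om (EFin \o h k)) ->
    mu.-integrable Om (EFin \o (fun x => \sum_(k <- r) h k x)) /\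
    \int[mu]_(x in Om) (\sum_(k <- r) h k x) = \sum_(k <- r) \int[mu]_(x in Om) h k x.
  move=> ih; elim: r => [|k r [i1 IH]].
    rewrite (_ : (fun x => _) = fun=> 0); last by apply/funext => x; rewrite big_nil.
    by rewrite big_nil Rintegral_cst// mul0r; split=> //; exact: integrable0.
  rewrite (_ : (fun x => _) = (fun x => h k x + \sum_(l <- r) h l x)); last first.
    by apply/funext => x; rewrite big_cons.
  rewrite big_cons -IH RintegralD//; split => //.
  by apply: (eq_integrable mOm (EFin \o h k \+ (EFin \o (fun x => \sum_(k <- r) h k x))))
    => //; exact: integrableD.
have ij i j : mu.-integrable Om (EFin \o (fun x => F x i j * G x i j)).
  exact: L2_mul_integrable.
have sumi i := sumE _ (index_enum 'I_n) _ (ij i).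
rewrite (sumE _ (index_enum 'I_m) _ (fun i => (sumi i).1)).2.
by apply: eq_bigr => i _; rewrite (sumi i).2.
Qed.

(** Membership in [H1] makes the chosen gradient square integrable, so that the
integral of the sum of its squared components splits. *)
Lemma h1norm_ge f : H1 f -> (l2norm f <= h1norm Om f) /\
  (forall i, l2norm (pgrad i f) <= h1norm Om f).
Proof.
move=> Hf; have Lg i j : L2 (fun x => grad Om f x i j).
  by rewrite (ord1 i); exact: pgrad_L2.
have g2 : l2normmx Om (grad Om f) ^+ 2 = \sum_j l2norm (pgrad j f) ^+ 2.
  rewrite sqr_sqrtr ipmxE// big_ord1; first by apply: eq_bigr => j _; rewrite l2norm_sqr.
  by apply: sumr_ge0 => j _; exact: ip_ge0.
rewrite /h1norm g2; have s0 : 0 <= \sum_j l2norm (pgrad j f) ^+ 2.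
  by apply: sumr_ge0 => j _; exact: sqr_ge0.
split=> [|i].
  by rewrite -[leLHS]ger0_norm ?l2norm_ge0// -sqrtr_sqr ler_wsqrtr// lerDl.
rewrite -[leLHS]ger0_norm ?l2norm_ge0// -sqrtr_sqr ler_wsqrtr//.
rewrite (bigD1 i)//= addrCA lerDl addr_ge0 ?sqr_ge0//.
by apply: sumr_ge0 => j _; exact: sqr_ge0.
Qed.

(** The approximation in [h1norm], split into its parts and expressed with the
classical derivatives of the test function. *)
Lemma H10_approx f e : H10 f -> 0 < e -> exists phi, [/\ test_fun Om phi,
  l2norm (fun x => f x - phi x) <= e &
  forall i, l2norm (fun x => pgrad i f x - partial i phi x) <= e].
Proof.
move=> [Hf /(_ e) ap] /ap[phi tp fe]; exists phi; split=> //.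
  have Hl : H1 (fun x => f x - phi x).
    have := H1_lin (-1) (test_H1 tp) Hf.
    by under eq_fun do rewrite mulN1r addrC.
  exact: le_trans (h1norm_ge Hl).1 (ltW fe).
move=> i.
have E' : (fun x => f x - phi x) = (fun x => -1 * phi x + f x).
  by apply/funext => x; rewrite mulN1r addrC.
have Hl := H1_lin (-1) (test_H1 tp) Hf.
have LB := L2B oOm (pgrad_L2 i Hf) (test_partial_L2 oOm bOm i tp).
apply: le_trans (ltW fe); rewrite E'; apply: le_trans ((h1norm_ge Hl).2 i).
rewrite (l2norm_ae oOm LB (pgrad_L2 i Hl))//.
have H1' := pgrad_lin i (-1) (test_H1 tp) Hf; have H2' := pgrad_test i tp.
apply: filterS2 H1' H2' => x /= x1 x2 Ox.
by rewrite [RHS]x1// [in RHS]x2// mulN1r addrC.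
Qed.

Lemma ip1 f : ip f (fun=> 1) = \int[mu]_(x in Om) f x.
Proof. by apply: eq_Rintegral => x _; rewrite mulr1. Qed.

Lemma le_eps_eq0 (a C : R) : 0 <= a -> (forall e, 0 < e -> a <= C * e) -> a = 0.
Proof.
move=> a0 aC; apply/eqP; rewrite eq_le a0 andbT; apply/ler_addgt0Pr => e e0.
have C0 : 0 < `|C| + 1 by rewrite ltr_wpDl.
rewrite add0r; apply: le_trans (aC (e / (`|C| + 1)) _) _; first by rewrite divr_gt0.
rewrite mulrA ler_pdivrMr// mulrC ler_pM2l//.
by apply: le_trans (ler_norm _) _; rewrite lerDl.
Qed.

(** The integral is a continuous functional of the gradient, and it vanishes for
test functions. *)
Lemma H10_integral_pgrad i f : H10 f -> \int[mu]_(x in Om) pgrad i f x = 0.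
Proof.
move=> Hf; have Lg := pgrad_L2 i Hf.1; have L1 := L2_cst oOm bOm 1.
apply/normr0_eq0; apply: (@le_eps_eq0 _ (l2norm (fun=> 1))) => // e e0.
have [phi [tp _ /(_ i) ge]] := H10_approx Hf e0.
have Lp := test_partial_L2 oOm bOm i tp; have LB := L2B oOm Lg Lp.
have -> : \int[mu]_(x in Om) pgrad i f x =
    ip (fun x => pgrad i f x - partial i phi x) (fun=> 1).
  by rewrite ipBl// !ip1 (test_integral_partial bOm i tp) subr0.
apply: le_trans (cauchy_schwarz oOm LB L1) _.
by rewrite mulrC ler_wpM2l ?l2norm_ge0.
Qed.

(** A single partial derivative controls the function, since [test_poincare] does
so on test functions with a constant depending on [Om] only. *)
Lemma H10_pgrad_eq0 i f : H10 f -> pgrad i f = (fun=> 0) %[ae mu in Om] ->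
  f = (fun=> 0) %[ae mu in Om].
Proof.
move=> Hf g0; have Lf := H1_L2 Hf.1; have Lg := pgrad_L2 i Hf.1.
have [M M0 OM] := bounded_sub_cube bOm.
apply: l2norm_eq0_ae => //; apply: (@le_eps_eq0 _ (1 + 2 * M)) => [|e e0].
  exact: l2norm_ge0.
have [phi [tp fe /(_ i) ge]] := H10_approx Hf e0.
have Lp := test_L2 oOm bOm tp; have Lq := test_partial_L2 oOm bOm i tp.
have -> : f = (fun x => (f x - phi x) + phi x) by apply/funext => x; rewrite subrK.
apply: le_trans (l2norm_triangle oOm (L2B oOm Lf Lp) Lp) _.
rewrite mulrDl mul1r lerD//; apply: le_trans (test_poincare oOm bOm i tp M0 OM) _.
rewrite ler_pM2l ?mulr_gt0//; apply: le_trans ge.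
rewrite -(l2normN oOm Lq) (l2norm_ae oOm (L2N oOm Lq) (L2B oOm Lg Lq))//.
by apply: filterS g0 => x /= gx Ox; rewrite gx// sub0r.
Qed.

End sobolev.

(** * Strain, divergence and mean-free part *)

Lemma sum_symmetrize {R : numFieldType} n (a : 'I_n -> 'I_n -> R) :
  \sum_i \sum_j a i j = \sum_i \sum_j 2^-1 * (a i j + a j i).
Proof.
under [RHS]eq_bigr do rewrite -mulr_sumr big_split/=.
rewrite -mulr_sumr big_split/= [X in _ = _ * (_ + X)]exchange_big/=.
set S := (X in _ * (X + _)); by rewrite -[S + S]mulr2n -[S *+ 2]mulr_natl mulKf ?pnatr_eq0.
Qed.

Section matrix_fields.
Context {R : realType} {d : nat} (Om : set 'rV[R]_d).
Hypotheses (oOm : open Om) (bOm : bounded_set Om).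
Local Notation E := 'rV[R]_d.
Local Notation mu := (lebesgue_rV d : {measure set E -> \bar R}).
Local Notation L2 := (L2 Om).
Local Notation H1 := (H1 Om).
Local Notation H10 := (H10 Om).
Local Notation ip := (ip Om).
Local Notation l2norm := (l2norm Om).
Local Notation pgrad := (pgrad Om).
Implicit Types f g h : E -> R.

Definition L2mx m n (F : E -> 'M[R]_(m, n)) := forall i j, L2 (fun x => F x i j).

Lemma ipmx_ge0 m n (F : E -> 'M[R]_(m, n)) : L2mx F -> 0 <= ipmx Om F F.
Proof.
move=> LF; rewrite (ipmxE oOm)//.
by do 2 (apply: sumr_ge0 => ? _); exact: ip_ge0.
Qed.

Lemma l2normmx_sqr m n (F : E -> 'M[R]_(m, n)) : L2mx F ->
  l2normmx Om F ^+ 2 = ipmx Om F F.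
Proof. by move=> LF; rewrite sqr_sqrtr// ipmx_ge0. Qed.

Lemma cauchy_schwarz_mx m n (F G : E -> 'M[R]_(m, n)) : L2mx F -> L2mx G ->
  `|ipmx Om F G| <= l2normmx Om F * l2normmx Om G.
Proof.
move=> LF LG; apply: discriminant_bound; try exact: ipmx_ge0.
move=> t; rewrite !(ipmxE oOm)// !mulr_sumr -!big_split; apply: sumr_ge0 => i _.
rewrite /= !mulr_sumr -!big_split; apply: sumr_ge0 => j _ /=.
have := ip_ge0 Om (fun x => F x i j + t * G x i j).
have Ltg := L2Z oOm t (LG i j); have Lh := L2D oOm (LF i j) Ltg.
rewrite !(ipDl oOm, ipDr oOm, ipZl oOm, ipZr oOm)//.
by rewrite (ipC _ (fun x => G x i j) (fun x => F x i j)); lra.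
Qed.

Lemma l2normmx_eq0_ae m n (F : E -> 'M[R]_(m, n)) i j : L2mx F ->
  l2normmx Om F = 0 -> (fun x => F x i j) = (fun=> 0) %[ae mu in Om].
Proof.
move=> LF F0; apply: (ip_eq0_ae oOm) => //.
have : ipmx Om F F = 0 by rewrite -l2normmx_sqr// F0 expr0n.
rewrite (ipmxE oOm)// => /psumr_eq0P s0.
have /psumr_eq0P := s0 (fun i _ => sumr_ge0 _ (fun j _ => ip_ge0 _ _)) i isT.
by move=> /(_ (fun j _ => ip_ge0 _ _)) /(_ j isT).
Qed.

Lemma grad_L2mx f : H1 f -> L2mx (grad Om f).
Proof. by move=> Hf i j; rewrite (ord1 i); exact: pgrad_L2. Qed.

Lemma ipmx_gradE f g : H1 f -> H1 g ->
  ipmx Om (grad Om f) (grad Om g) = \sum_j ip (pgrad j f) (pgrad j g).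
Proof.
by move=> Hf Hg; rewrite (ipmxE oOm) ?big_ord1//; exact: grad_L2mx.
Qed.

Lemma H1N f : H1 f -> H1 (fun x => - f x).
Proof.
move=> /(@H1_lin _ _ _ oOm bOm (-1) f (fun=> 0)) /(_ (H1_0 oOm bOm)).
by under eq_fun do rewrite mulN1r addr0.
Qed.

Lemma pgradN i f : H1 f ->
  pgrad i (fun x => - f x) = (fun x => - pgrad i f x) %[ae mu in Om].
Proof.
move=> Hf; have H0 := H1_0 oOm bOm.
have g1 := pgrad_lin oOm bOm i (-1) Hf H0.
have g2 := pgrad_ae0 oOm bOm i H0 (@ae_eq_refl _ _ _ _ _ _ _).
have -> : (fun x => - f x) = (fun x => -1 * f x + 0).
  by apply/funext => x; rewrite mulN1r addr0.
by apply: filterS2 g1 g2 => x /= x1 x2 Ox; rewrite x1// x2// mulN1r addr0.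
Qed.

Lemma ipmx_gradNr f g : H1 f -> H1 g ->
  ipmx Om (grad Om f) (grad Om (fun x => - g x)) =
  - ipmx Om (grad Om f) (grad Om g).
Proof.
move=> Hf Hg; have HN := H1N Hg; rewrite !ipmx_gradE// -sumrN; apply: eq_bigr => j _.
have [Lf Lg] := (pgrad_L2 j Hf, pgrad_L2 j Hg).
rewrite ipC (ip_ae oOm (pgrad_L2 j HN) (L2N oOm Lg) Lf (pgradN j Hg)).
by rewrite (ipNl oOm Lg Lf) ipC.
Qed.

Lemma l2normmx_gradN f : H1 f ->
  l2normmx Om (grad Om (fun x => - f x)) = l2normmx Om (grad Om f).
Proof.
move=> Hf; have HN := H1N Hf; rewrite /l2normmx ipmx_gradNr//.
rewrite !ipmx_gradE//; congr Num.sqrt; rewrite -sumrN; apply: eq_bigr => j _.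
have Lf := pgrad_L2 j Hf.
rewrite (ip_ae oOm (pgrad_L2 j HN) (L2N oOm Lf) Lf (pgradN j Hf)).
by rewrite (ipNl oOm Lf Lf) opprK.
Qed.

Lemma ipmx_grad0r f : H1 f -> ipmx Om (grad Om f) (grad Om (fun=> 0)) = 0.
Proof.
move=> Hf; have H0 := H1_0 oOm bOm; rewrite ipmx_gradE// big1// => j _.
rewrite ipC (ip_ae0 oOm bOm)//; try exact: pgrad_L2.
exact: pgrad_ae0 (@ae_eq_refl _ _ _ _ _ _ _).
Qed.

Lemma ip0r f : L2 f -> ip f (fun=> 0) = 0.
Proof.
move=> Lf; rewrite ipC.
exact: (ip_ae0 oOm bOm (L2_cst oOm bOm 0) Lf (@ae_eq_refl _ _ _ _ _ _ _)).
Qed.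

Section vector_fields.
Variable u : E -> 'rV[R]_d.
Hypothesis Hu : H10v Om u.

Let L2u i j : L2 (pgrad j (component u i)).
Proof. exact: pgrad_L2 (Hu i).1. Qed.

Lemma strainE i j : (fun x => strain Om u x i j) = (fun x =>
  2^-1 * (pgrad j (component u i) x + pgrad i (component u j) x)).
Proof. by apply/funext => x; rewrite !mxE. Qed.

Lemma strain_L2mx : L2mx (strain Om u).
Proof. by move=> i j; rewrite strainE; apply: L2Z => //; exact: L2D. Qed.

Lemma divergE : diverg Om u = (fun x => \sum_i pgrad i (component u i) x).
Proof. by apply/funext => x; apply: eq_bigr => i _; rewrite mxE. Qed.

Lemma diverg_L2 : L2 (diverg Om u).
Proof. by rewrite divergE; exact: L2_sum. Qed.

Lemma integral_diverg_eq0 : \int[mu]_(x in Om) diverg Om u x = 0.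
Proof.
rewrite divergE -ip1; have L1 := L2_cst oOm bOm 1.
elim: (index_enum _) => [|i r IH].
  by under eq_fun do rewrite big_nil; rewrite ipC ip0r.
have -> : (fun x => \sum_(j <- i :: r) pgrad j (component u j) x) =
    (fun x => pgrad i (component u i) x + \sum_(j <- r) pgrad j (component u j) x).
  by apply/funext => x; rewrite big_cons.
have Ls : L2 (fun x => \sum_(j <- r) pgrad j (component u j) x) by exact: L2_sum.
by rewrite (ipDl oOm (L2u i i) Ls L1) IH addr0 ip1 H10_integral_pgrad.
Qed.

(** The symmetric part of the Jacobian is no larger than the Jacobian, and
[h1normv] bounds the latter. *)
Lemma strain_le_h1normv : l2normmx Om (strain Om u) <= h1normv Om u.
Proof.
rewrite ler_wsqrtr//.
have -> : ipmx Om (strain Om u) (strain Om u) = \sum_i \sum_j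
    4^-1 * (l2norm (pgrad j (component u i)) ^+ 2 +
      2 * ip (pgrad j (component u i)) (pgrad i (component u j)) +
      l2norm (pgrad i (component u j)) ^+ 2).
  rewrite (ipmxE oOm); try exact: strain_L2mx.
  apply: eq_bigr => i _; apply: eq_bigr => j _; rewrite strainE.
  have Ls := L2D oOm (L2u i j) (L2u j i); have LZ := L2Z oOm 2^-1 Ls.
  rewrite !(ipZl oOm, ipZr oOm)// !(ipDl oOm, ipDr oOm)// !l2norm_sqr.
  by rewrite (ipC _ (pgrad i _) (pgrad j _)); field.
have h1E i : h1norm Om (component u i) ^+ 2 =
    l2norm (component u i) ^+ 2 + \sum_j l2norm (pgrad j (component u i)) ^+ 2.
  have Hi := (Hu i).1; rewrite sqr_sqrtr ?addr_ge0 ?sqr_ge0//; congr (_ + _).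
  rewrite l2normmx_sqr ?ipmx_gradE//; last exact: grad_L2mx.
  by apply: eq_bigr => j _; rewrite l2norm_sqr.
apply: (@le_trans _ _ (\sum_i \sum_j l2norm (pgrad j (component u i)) ^+ 2)); last first.
  by apply: ler_sum => i _; rewrite h1E lerDr sqr_ge0.
rewrite [leRHS]sum_symmetrize; apply: ler_sum => i _; apply: ler_sum => j _.
have /ler_normlP[_ cs] := cauchy_schwarz oOm (L2u i j) (L2u j i).
have := sqr_ge0 (l2norm (pgrad j (component u i)) - l2norm (pgrad i (component u j))).
by nra.
Qed.

(** The diagonal entry [d_k u_k] vanishes, and [H10_pgrad_eq0] in direction [k]
gives [u_k = 0]. *)
Lemma strain_eq0_ae : l2normmx Om (strain Om u) = 0 -> u = (fun=> 0) %[ae mu in Om].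
Proof.
move=> s0; have : forall k, component u k = (fun=> 0) %[ae mu in Om].
  move=> k; apply: (H10_pgrad_eq0 oOm bOm (i := k)) => //.
  apply: filterS (l2normmx_eq0_ae k k strain_L2mx s0) => x /= xE Ox.
  by have := xE Ox; have /= -> := congr1 (fun F => F x) (strainE k k); lra.
move=> /filter_forall; apply: filterS => x /= xE Ox; apply/rowP => k.
by rewrite mxE; exact: xE.
Qed.

End vector_fields.

Lemma grad_eq0_ae f : (0 < d)%N -> H10 f -> l2normmx Om (grad Om f) = 0 ->
  f = (fun=> 0) %[ae mu in Om].
Proof.
move=> d0 Hf g0; apply: (H10_pgrad_eq0 oOm bOm (i := Ordinal d0)) => //.
exact: (l2normmx_eq0_ae ord0 (Ordinal d0) (grad_L2mx Hf.1) g0).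
Qed.

Lemma mean_free_L2 f : L2 f -> L2 (mean_free Om f).
Proof. by move=> Lf; apply: L2B => //; exact: L2_cst. Qed.

Lemma integral_mean_free f : L2 f -> \int[mu]_(x in Om) mean_free Om f x = 0.
Proof.
move=> Lf; have mOm := measurable_domain oOm; have Lc := L2_cst oOm bOm (mean Om f).
rewrite RintegralB//; try exact: L2_integrable.
rewrite Rintegral_cst// /mean.
have [m0|m0] := eqVneq (fine (mu Om)) 0; last by rewrite divfK// subrr.
have muO : mu Om = 0%E.
  by rewrite -[LHS]fineK ?m0// ge0_fin_numE//; exact: domain_lty.
by rewrite m0 mulr0 subr0 /Rintegral null_set_integral//; 
  exact: (measurable_int _ (L2_integrable oOm bOm Lf)).
Qed.

Lemma mean_freeN f : L2 f ->
  mean_free Om (fun x => - f x) = (fun x => - mean_free Om f x).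
Proof.
move=> Lf; have L1 := L2_cst oOm bOm 1.
have -> : mean_free Om (fun x => - f x) =
    (fun x => - f x - (\int[mu]_(x in Om) - f x) / fine (mu Om)) by [].
rewrite -(ip1 _ (fun x => - f x)) (ipNl oOm)// ip1.
by apply/funext => x; rewrite /mean_free /mean; lra.
Qed.

End matrix_fields.

(** * The bilinear form on the two test elements *)

Lemma sum7_eq0 {R : realDomainType} (a b c e f g h : R) :
  0 <= a -> 0 <= b -> 0 <= c -> 0 <= e -> 0 <= f -> 0 <= g -> 0 <= h ->
  0 = a + b + c + e + f + g + h -> [/\ a = 0, b = 0, e = 0 & g = 0].
Proof. by move=> *; split; lra. Qed.

(** The quadratic form [Q] of [(xi, p, T)] is used at [xi - al p - be T], which
appears in the energy, and at the three differences of the vectors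
[xi - al p - be T], [al p], [be T]: by the identity
[3 (|a|^2 + |b|^2 + |c|^2) - |a + b + c|^2 = |a - b|^2 + |b - c|^2 + |a - c|^2]
these bound [|xi|^2] by three times the squares available. *)
Lemma flip_energy {R : realFieldType}
    (A GP GT X PP TT XP XT PT D il al be k th c0 a0 b0 : R) :
  0 <= A -> 0 <= GP -> 0 <= GT -> 0 <= PP -> 0 <= TT ->
  (forall a b c, 0 <= a ^+ 2 * X + b ^+ 2 * PP + c ^+ 2 * TT +
    2 * (a * b) * XP + 2 * (a * c) * XT + 2 * (b * c) * PT) ->
  0 < il -> 0 <= k -> 0 <= th -> 0 <= b0 ->
  al ^+ 2 * il <= c0 - b0 -> be ^+ 2 * il <= a0 - b0 ->
  A + il * X + (c0 - b0) * PP + k * GP + (a0 - b0) * TT + th * GT <=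
  4 * (A - D - - D - il * - X + al * il * - XP + be * il * - XT
    + al * il * - XP - (c0 + al ^+ 2 * il) * - PP - k * - GP
    - (al * be * il - b0) * - PT
    + be * il * - XT - (al * be * il - b0) * - PT - (a0 + be ^+ 2 * il) * - TT
    - th * - GT).
Proof.
move=> A0 GP0 GT0 PP0 TT0 Q il0 k0 th0 b00 hp hT.
have m1 := mulr_ge0 (ltW il0) (Q 1 (- al) (- be)).
have m2 := mulr_ge0 (ltW il0) (Q 1 (- (2 * al)) (- be)).
have m3 := mulr_ge0 (ltW il0) (Q 0 al (- be)).
have m4 := mulr_ge0 (ltW il0) (Q 1 (- al) (- (2 * be))).
have m5 := mulr_ge0 b00 (Q 0 1 (-1)).
have m6 : al ^+ 2 * il * PP <= (c0 - b0) * PP by rewrite ler_wpM2r.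
have m7 : be ^+ 2 * il * TT <= (a0 - b0) * TT by rewrite ler_wpM2r.
have m8 := mulr_ge0 k0 GP0; have m9 := mulr_ge0 th0 GT0.
lra.
Qed.

Section energy.
Context {R : realType} {d : nat} (Om : set 'rV[R]_d).
Hypotheses (oOm : open Om) (bOm : bounded_set Om).
Local Notation E := 'rV[R]_d.
Local Notation mu := (lebesgue_rV d : {measure set E -> \bar R}).
Local Notation L2 := (L2 Om).
Local Notation H10 := (H10 Om).
Local Notation ip := (ip Om).
Local Notation l2norm := (l2norm Om).
Implicit Types (P : params R) (x : state (R := R) (d := d)).

Lemma ip_comb_ge0 (f g h : E -> R) (a b c : R) : L2 f -> L2 g -> L2 h ->
  0 <= a ^+ 2 * ip f f + b ^+ 2 * ip g g + c ^+ 2 * ip h h +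
       2 * (a * b) * ip f g + 2 * (a * c) * ip f h + 2 * (b * c) * ip g h.
Proof.
move=> Lf Lg Lh; have := ip_ge0 Om (fun z => a * f z + (b * g z + c * h z)).
have La := L2Z oOm a Lf; have Lb := L2Z oOm b Lg; have Lc := L2Z oOm c Lh.
have Lbc := L2D oOm Lb Lc; have Labc := L2D oOm La Lbc.
rewrite (ipDl oOm La Lbc Labc) (ipDl oOm Lb Lc Labc).
rewrite !(ipDr oOm La Lbc, ipDr oOm Lb Lc)//.
rewrite !(ipZl oOm, ipZr oOm)//.
by rewrite (ipC _ g f) (ipC _ h f) (ipC _ h g); lra.
Qed.

Definition conforming x :=
  [/\ H10v Om (su x), L2 (sxi x), H10 (sp x) & H10 (sT x)].

(** The squared norm without the contribution of the mean-free part of [xi]: the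
part that the energy estimate controls. *)
Definition normB2_rest P x : R :=
  l2normmx Om (strain Om (su x)) ^+ 2 + (plam P)^-1 * l2norm (sxi x) ^+ 2 +
  Cp P * l2norm (sp x) ^+ 2 + tK P * l2normmx Om (grad Om (sp x)) ^+ 2 +
  CT P * l2norm (sT x) ^+ 2 + ttheta P * l2normmx Om (grad Om (sT x)) ^+ 2.

Lemma adm_signs P : admissible P -> [/\ 0 < (plam P)^-1, 0 <= Cp P, 0 <= CT P,
  0 < tK P & 0 < ttheta P].
Proof.
move=> [_ dt0 [K0 th0] [l0 _] _ [ab cb]].
by rewrite invr_gt0 !subr_ge0 !mulr_gt0.
Qed.

Lemma normB2_rest_ge P x : admissible P ->
  l2normmx Om (strain Om (su x)) ^+ 2 <= normB2_rest P x.
Proof.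
move=> /adm_signs[l0 p0 t0 k0 h0]; rewrite /normB2_rest -!addrA lerDl.
by rewrite !addr_ge0// mulr_ge0 ?sqr_ge0// ltW.
Qed.

Lemma normB2_sqr P x : admissible P ->
  normB2 Om P x ^+ 2 = normB2_rest P x + l2norm (mean_free Om (sxi x)) ^+ 2.
Proof.
move=> aP; have r0 : 0 <= normB2_rest P x.
  by apply: le_trans (normB2_rest_ge x aP); exact: sqr_ge0.
have E0 := addr_ge0 r0 (sqr_ge0 (l2norm (mean_free Om (sxi x)))).
rewrite -[RHS]sqr_sqrtr//; case: x {r0} E0 => u xi p t /= E0.
apply: (congr1 (fun z => Num.sqrt z ^+ 2)); rewrite /normB2_rest /=.
move: (_ ^+ 2) (_^-1 * _) (l2norm (mean_free _ _) ^+ 2) (Cp P * _) (tK P * _)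
  (CT P * _) (ttheta P * _) => a b c e f g h.
by ring.
Qed.

(** When [Cp] or [CT] vanishes the norm sees [p] or [T] only through its gradient,
so positivity relies on [grad_eq0_ae]. *)
Lemma normB2_gt0 P x : (0 < d)%N -> admissible P -> conforming x ->
  nonzero_state Om x -> 0 < normB2 Om P x.
Proof.
move=> d0 aP [Hu Lxi Hp HT] nx; rewrite lt_def; apply/andP; split; last first.
  by case: {Hu Lxi Hp HT nx} x => *; exact: sqrtr_ge0.
apply/eqP => N0; have := normB2_sqr x aP; rewrite N0 expr0n/=.
have [l0 p0 t0 k0 h0] := adm_signs aP; rewrite /normB2_rest.
have e0 := sqr_ge0 (l2normmx Om (strain Om (su x))).
have x0 := mulr_ge0 (ltW l0) (sqr_ge0 (l2norm (sxi x))).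
have q0 := mulr_ge0 p0 (sqr_ge0 (l2norm (sp x))).
have q1 := mulr_ge0 (ltW k0) (sqr_ge0 (l2normmx Om (grad Om (sp x)))).
have q2 := mulr_ge0 t0 (sqr_ge0 (l2norm (sT x))).
have q3 := mulr_ge0 (ltW h0) (sqr_ge0 (l2normmx Om (grad Om (sT x)))).
have m0 := sqr_ge0 (l2norm (mean_free Om (sxi x))) => sum0.
have [s0 xi0 gp0 gT0] := sum7_eq0 e0 x0 q0 q1 q2 q3 m0 sum0.
have sqr0 c z : 0 < c -> c * z ^+ 2 = 0 -> z = 0 :> R.
  by move=> c0 /eqP; rewrite mulf_eq0 gt_eqF//= sqrf_eq0 => /eqP.
case: nx; apply.
- by apply: (strain_eq0_ae oOm bOm Hu); apply: (sqr0 1) => //; rewrite mul1r.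
- exact: (l2norm_eq0_ae oOm Lxi (sqr0 _ _ l0 xi0)).
- exact: (grad_eq0_ae oOm bOm d0 Hp (sqr0 _ _ k0 gp0)).
- exact: (grad_eq0_ae oOm bOm d0 HT (sqr0 _ _ h0 gT0)).
Qed.

Definition flip x := State (su x) (fun z => - sxi x z)
  (fun z => - sp x z) (fun z => - sT x z).

Lemma nonzero_aeN (f : E -> R) : nonzero_ae Om f -> nonzero_ae Om (fun z => - f z).
Proof.
apply: contra_not; apply: filterS => z /= fz Oz.
by apply: oppr_inj; rewrite fz// oppr0.
Qed.

Lemma nonzero_flip x : nonzero_state Om x -> nonzero_state Om (flip x).
Proof.
by case=> nx; [apply: Or41|apply: Or42|apply: Or43|apply: Or44] => //;
  exact: nonzero_aeN.
Qed.

Lemma normB2_flip P x : conforming x -> normB2 Om P (flip x) = normB2 Om P x.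
Proof.
case: x => u xi p t [/= Hu Lxi Hp HT]; rewrite /normB2 /flip/=.
rewrite (mean_freeN oOm bOm Lxi) (l2normN oOm (mean_free_L2 oOm bOm Lxi)).
rewrite (l2normN oOm Lxi) (l2normN oOm Hp.1.1) (l2normN oOm HT.1.1).
by rewrite (l2normmx_gradN oOm bOm Hp.1) (l2normmx_gradN oOm bOm HT.1).
Qed.

Lemma normB2_restE P x : conforming x -> normB2_rest P x =
  ipmx Om (strain Om (su x)) (strain Om (su x)) +
  (plam P)^-1 * ip (sxi x) (sxi x) +
  Cp P * ip (sp x) (sp x) + tK P * ipmx Om (grad Om (sp x)) (grad Om (sp x)) +
  CT P * ip (sT x) (sT x) + ttheta P * ipmx Om (grad Om (sT x)) (grad Om (sT x)).
Proof.
move=> [Hu Lxi Hp HT]; rewrite /normB2_rest.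
rewrite -(l2normmx_sqr oOm (strain_L2mx oOm Hu)).
congr (_ + _ * _ + _ * _ + _ * _ + _ * _ + _ * _).
- exact: l2norm_sqr.
- exact: l2norm_sqr.
- exact: (l2normmx_sqr oOm (grad_L2mx Hp.1)).
- exact: l2norm_sqr.
- exact: (l2normmx_sqr oOm (grad_L2mx HT.1)).
Qed.

Lemma Ah_flip P x : admissible P ->
  palpha P ^+ 2 / plam P <= Cp P -> pbeta P ^+ 2 / plam P <= CT P ->
  conforming x -> normB2_rest P x <= 4 * Ah Om P x (flip x).
Proof.
move=> aP hp hT cx; rewrite normB2_restE//; case: x cx => u xi p t [/= Hu Lxi Hp HT].
have [l0 p0 t0 k0 h0] := adm_signs aP.
have [_ _ _ [lam0 _] [_ _ _ b0 _] _] := aP.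
have [Lp LT] := (Hp.1.1, HT.1.1); have Ld := diverg_L2 oOm bOm Hu.
rewrite /Ah/= (ipNr oOm Lxi Ld) (ipNr oOm Lxi Lxi) (ipNr oOm Lxi Lp).
rewrite (ipNr oOm Lxi LT) (ipNr oOm Lp Lxi) (ipNr oOm Lp Lp) (ipNr oOm Lp LT).
rewrite (ipNr oOm LT Lxi) (ipNr oOm LT Lp) (ipNr oOm LT LT).
rewrite (ipmx_gradNr oOm bOm Hp.1 Hp.1) (ipmx_gradNr oOm bOm HT.1 HT.1).
rewrite (ipC _ p xi) (ipC _ t xi) (ipC _ t p).
exact: (flip_energy _ (ipmx_ge0 oOm (strain_L2mx oOm Hu))
  (ipmx_ge0 oOm (grad_L2mx Hp.1)) (ipmx_ge0 oOm (grad_L2mx HT.1))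
  (ip_ge0 Om p) (ip_ge0 Om t) (fun a b c => ip_comb_ge0 a b c Lxi Lp LT)
  l0 (ltW k0) (ltW h0) b0 hp hT).
Qed.

Definition displacement (w : E -> 'rV[R]_d) :=
  State w (fun=> 0) (fun=> 0) (fun=> 0).

Lemma Ah_displacement P x w : conforming x -> H10v Om w ->
  Ah Om P x (displacement w) =
  ipmx Om (strain Om (su x)) (strain Om w) - ip (diverg Om w) (sxi x).
Proof.
case: x => u xi p t [/= Hu Lxi Hp HT] Hw.
have Ld := diverg_L2 oOm bOm Hu.
rewrite /Ah/= (ip0r oOm bOm Ld) (ip0r oOm bOm Lxi) (ip0r oOm bOm Hp.1.1).
rewrite (ip0r oOm bOm HT.1.1) (ipmx_grad0r oOm bOm Hp.1) (ipmx_grad0r oOm bOm HT.1).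
lra.
Qed.

Lemma normB2_displacement P w :
  normB2 Om P (displacement w) = l2normmx Om (strain Om w).
Proof.
have L0 := L2_cst oOm bOm 0; have H0 := H1_0 oOm bOm.
have n0 : l2norm (fun=> 0) = 0 by rewrite /Defs.l2norm (ip0r oOm bOm L0) sqrtr0.
have g0 : l2normmx Om (grad Om (fun=> 0)) = 0.
  by rewrite /l2normmx (ipmx_grad0r oOm bOm H0) sqrtr0.
have m0 : mean_free Om (fun=> 0) = (fun=> 0).
  apply/funext => z; rewrite /mean_free /mean Rintegral_cst ?mul0r ?mul0r ?subr0//.
  exact: measurable_domain.
rewrite /normB2 /= m0 n0 g0 !expr0n/= !mulr0 !addr0 sqrtr_sqr ger0_norm//.
exact: sqrtr_ge0.
Qed.

End energy.

(** * The two cases and the inf-sup bound *)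

(** Arithmetic of the case where [Z] dominates the mean-free part [n]. *)
Lemma energy_ratio {R : realFieldType} (N Z n A k : R) : 0 < N -> 0 <= k ->
  N ^+ 2 = Z + n ^+ 2 -> n ^+ 2 <= k * Z -> Z <= 4 * A ->
  4^-1 / (1 + k) <= A / (N * N).
Proof.
move=> N0 k0 N2 nZ ZA; have k1 : 0 < 1 + k by rewrite ltr_pwDl.
rewrite ler_pdivlMr ?mulr_gt0// -expr2 N2 mulrAC ler_pdivrMr//.
have : 0 <= (1 + k) * (4 * A - Z) by rewrite mulr_ge0 ?subr_ge0// ltW.
by lra.
Qed.

(** Arithmetic of the case where the mean-free part [n] dominates, with
[g = gamma / 4]: then [e <= g n] and [N <= (1 + g) n]. *)
Lemma pressure_ratio {R : realFieldType} (g N Z n e s h a b : R) :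
  0 < g -> 0 < N -> 0 < n -> 0 < s -> N ^+ 2 = Z + n ^+ 2 ->
  g ^- 2 * Z < n ^+ 2 -> e ^+ 2 <= Z -> s <= h -> 2 * g * n * h <= - b ->
  - a <= e * s -> g / (1 + g) <= (a - b) / (N * s).
Proof.
move=> g0 N0 n0 s0 N2 Zn eZ sh bn ae; have g1 : 0 < 1 + g by rewrite addr_gt0.
have gn : 0 < g * n by rewrite mulr_gt0.
have {}Zn : Z < (g * n) ^+ 2 by rewrite exprMn -ltr_pdivrMl// exprn_gt0.
have en : e <= g * n.
  rewrite leNgt; apply/negP => gne.
  have : (g * n) ^+ 2 < e ^+ 2 by rewrite ltrXn2r// ltW.
  by move=> /(lt_trans Zn); rewrite ltNge eZ.
have Nn : N <= (1 + g) * n.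
  rewrite -(ler_pXn2r (n := 2))// ?nnegrE ?mulr_ge0 ?(ltW N0) ?(ltW n0) ?(ltW g1)//.
  have := mulr_ge0 (ltW gn) (ltW n0); rewrite N2; move: Zn; nra.
rewrite ler_pdivlMr ?mulr_gt0// mulrAC ler_pdivrMr//.
have ab : g * n * s <= a - b.
  have := ler_wpM2r (ltW s0) en; have := ler_wpM2l (ltW gn) sh.
  by move: bn ae; lra.
apply: le_trans (ler_wpM2r (ltW g1) ab).
have := ler_wpM2l (ltW (mulr_gt0 g0 s0)) Nn; lra.
Qed.

Section infsup.
Context {R : realType} {X Y : Type}.
Variables (b : X -> Y -> R) (nX : X -> R) (nY : Y -> R) (A : set X) (B : set Y).

Lemma infsup_ge (z : R) :
  (forall x, A x -> exists2 y, B y & z <= b x y / (nX x * nY y)) ->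
  (z%:E <= infsup b nX nY A B)%E.
Proof.
move=> H; apply: le_ereal_inf_tmp => _ [x Ax <-].
have [y By zy] := H x Ax; apply: (@le_trans _ _ (b x y / (nX x * nY y))%:E).
  by rewrite lee_fin.
by apply: ereal_sup_ubound; exists y.
Qed.

Lemma infsup_witness (z z' : R) x : (z%:E <= infsup b nX nY A B)%E -> z' < z -> A x ->
  exists2 y, B y & z' < b x y / (nX x * nY y).
Proof.
move=> zi z'z Ax.
have : (z'%:E < ereal_sup [set (b x y / (nX x * nY y))%:E | y in B])%E.
  apply: (@lt_le_trans _ _ z%:E); first by rewrite lte_fin.
  by apply: le_trans zi _; apply: ereal_inf_lbound; exists x.
by move=> /ereal_sup_gt[_ [y By <-]]; rewrite lte_fin; exists y.
Qed.

End infsup.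

Section stability.
Context {R : realType} {d : nat} (Om : set 'rV[R]_d).
Hypotheses (oOm : open Om) (bOm : bounded_set Om) (d0 : (0 < d)%N).
Local Notation E := 'rV[R]_d.
Variables (Vh : set (E -> E)) (Qh Wh : set (E -> R)).
Hypotheses (hVh : Vh `<=` H10v Om) (hQh : Qh `<=` L2 Om) (hWh : Wh `<=` H10 Om).
Hypotheses (Q0 : Qh (fun=> 0)) (W0 : Wh (fun=> 0)).
Hypotheses (QN : forall f, Qh f -> Qh (fun x => - f x))
  (WN : forall f, Wh f -> Wh (fun x => - f x)).
Hypothesis Qm : forall xi, Qh xi -> Qh (mean_free Om xi).
Variable gamma : R.
Hypotheses (gamma0 : 0 < gamma)
  (hinfsup : (gamma%:E <= infsup (fun xi v => ip Om (diverg Om v) xi)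
                   (l2norm Om) (h1normv Om)
                   [set xi | (Qh `&` L20 Om) xi /\ nonzero_ae Om xi]
                   [set v | Vh v /\ nonzero_ae Om v])%E).

Lemma Xh_conforming x : Xh Vh Qh Wh x -> conforming Om x.
Proof. by move=> [/hVh ? /hQh ? /hWh ? /hWh ?]. Qed.

Lemma Xh_flip x : Xh Vh Qh Wh x -> Xh Vh Qh Wh (flip x).
Proof. by move=> [? /QN ? /WN ? /WN ?]. Qed.

(** The inf-sup condition is applied to [- xi0], the sign that makes
[- (div w, xi)] positive in the form; the mean of [xi] does not contribute
because [div w] has integral [0]. The constant drops to [gamma / 2] because the
supremum need not be attained. *)
Lemma pressure_witness xi : Qh xi -> 0 < l2norm Om (mean_free Om xi) ->
  exists2 w, Vh w /\ nonzero_ae Om w &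
    gamma / 2 * l2norm Om (mean_free Om xi) * h1normv Om w <= - ip Om (diverg Om w) xi.
Proof.
move=> Qxi n0; have Lxi := hQh Qxi; have Lm := mean_free_L2 oOm bOm Lxi.
have LN := L2N oOm Lm; have QmN : Qh (fun x => - mean_free Om xi x) by exact/QN/Qm.
have nz : nonzero_ae Om (fun x => - mean_free Om xi x).
  move=> m0; move: n0; rewrite -(l2normN oOm Lm) (l2norm_ae oOm LN (L2_cst oOm bOm 0) m0).
  by rewrite /l2norm (ip0r oOm bOm (L2_cst oOm bOm 0)) sqrtr0 ltxx.
have mN0 : \int[(lebesgue_rV d : {measure set E -> \bar R})]_(x in Om)
    (- mean_free Om xi x) = 0.
  by rewrite -ip1 (ipNl oOm Lm (L2_cst oOm bOm 1)) ip1 (integral_mean_free oOm bOm Lxi) oppr0.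
have [||w [Vw nw]] := infsup_witness hinfsup (z' := gamma / 2)
    (x := fun x => - mean_free Om xi x).
- by rewrite ltr_pdivrMr// mulr2n mulrDr mulr1 ltrDl.
- by split.
have Hw := hVh Vw; have Ld := diverg_L2 oOm bOm Hw.
have dE : ip Om (diverg Om w) (fun x => - mean_free Om xi x) = - ip Om (diverg Om w) xi.
  rewrite (ipNr oOm Lm Ld); congr (- _).
  rewrite (ipBr oOm Lxi (L2_cst oOm bOm _) Ld) [X in _ - X](_ : _ = 0) ?subr0//.
  have := ipZr oOm (mean Om xi) (L2_cst oOm bOm 1) Ld; rewrite mulr1 => ->.
  by rewrite ip1 (integral_diverg_eq0 oOm bOm Hw) mulr0.
rewrite dE (l2normN oOm Lm) => gw; exists w => //.
have [h0|h0] := eqVneq (h1normv Om w) 0.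
  by move: gw; rewrite h0 mulr0 invr0 mulr0 ltNge divr_ge0// ltW.
have hp : 0 < h1normv Om w by rewrite lt_def h0 sqrtr_ge0.
by rewrite -mulrA -ler_pdivlMr ?mulr_gt0// ltW.
Qed.

(** The bounds of [energy_ratio] at [k = (4 / gamma) ^ 2] and of [pressure_ratio]
at [g = gamma / 4]. *)
Definition stability_constant : R :=
  Num.min (4^-1 / (1 + (4 / gamma) ^+ 2)) (gamma / 4 / (1 + gamma / 4)).

Lemma stability_constant_gt0 : 0 < stability_constant.
Proof.
have g4 : 0 < gamma / 4 by rewrite divr_gt0.
by rewrite lt_min !divr_gt0// ?addr_gt0// ?exprn_gt0 ?divr_gt0.
Qed.

Lemma infsup_stability P : admissible P ->
  palpha P ^+ 2 / plam P <= Cp P -> pbeta P ^+ 2 / plam P <= CT P ->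
  (stability_constant%:E <= infsup (Ah Om P) (normB2 Om P) (normB2 Om P)
                    [set x | Xh Vh Qh Wh x /\ nonzero_state Om x]
                    [set y | Xh Vh Qh Wh y /\ nonzero_state Om y])%E.
Proof.
move=> aP hp hT; apply: infsup_ge => x [Xx nx]; have cx := Xh_conforming Xx.
have N0 := normB2_gt0 oOm bOm d0 aP cx nx.
have N2 := normB2_sqr Om x aP.
set N := normB2 Om P x in N0 N2 *; set Z := normB2_rest Om P x in N2.
set n := l2norm Om (mean_free Om (sxi x)) in N2.
have n0 : 0 <= n by exact: sqrtr_ge0.
have [small|large] := leP (n ^+ 2) ((4 / gamma) ^+ 2 * Z).
  exists (flip x); first by split; [exact: Xh_flip|exact: nonzero_flip].
  rewrite (normB2_flip oOm bOm P cx) -/N.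
  have AZ := Ah_flip oOm bOm aP hp hT cx; rewrite -/Z in AZ.
  apply: le_trans (energy_ratio N0 (sqr_ge0 _) N2 small AZ).
  by rewrite ge_min lexx.
have e2 := normB2_rest_ge Om x aP; rewrite -/Z in e2.
set e := l2normmx Om (strain Om (su x)) in e2.
have e0 : 0 <= e by exact: sqrtr_ge0.
have [Vu Qxi _ _] := Xx.
have np : 0 < n.
  rewrite lt_def n0 andbT; apply/eqP => nE; move: large.
  by rewrite nE expr0n/= ltNge mulr_ge0 ?sqr_ge0//; apply: le_trans e2; exact: sqr_ge0.
have [w [Vw nw] gw] := pressure_witness Qxi np.
have Hw := hVh Vw; have [Hu _ _ _] := cx.
have Xw : Xh Vh Qh Wh (displacement w) by split.
have nsw : nonzero_state Om (displacement w) by exact: Or41.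
exists (displacement w) => //.
have s0 := normB2_gt0 oOm bOm d0 aP (Xh_conforming Xw) nsw.
rewrite (Ah_displacement oOm bOm P cx Hw) (normB2_displacement oOm bOm).
rewrite (normB2_displacement oOm bOm) in s0.
have sh := strain_le_h1normv oOm Hw.
have /ler_normlP[cs _] : `|ipmx Om (strain Om (su x)) (strain Om w)| <=
    e * l2normmx Om (strain Om w).
  exact: (cauchy_schwarz_mx oOm (strain_L2mx oOm Hu) (strain_L2mx oOm Hw)).
have g4 : 0 < gamma / 4 by rewrite divr_gt0.
have Zn : (gamma / 4) ^- 2 * Z < n ^+ 2 by rewrite -exprVn invf_div.
have bn : 2 * (gamma / 4) * n * h1normv Om w <= - ip Om (diverg Om w) (sxi x).
  by rewrite (_ : 2 * (gamma / 4) = gamma / 2)//; field.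
apply: le_trans (pressure_ratio g4 N0 np s0 N2 Zn e2 sh bn cs).
by rewrite ge_min lexx orbT.
Qed.

End stability.

Theorem theorem4p2 (R : realType) (d : nat) (hd : d = 2%N \/ d = 3%N)
  (Om : set 'rV[R]_d) (hOm : lipschitz_polyhedral_domain Om)
  (I : Type) (Th : I -> seq (simplex R d)) (sigma tau : R)
  (hTh : forall i, triangulation Om (Th i))
  (hshape : forall i, shape_regular sigma (Th i))
  (hquasi : forall i, quasi_uniform tau (Th i))
  (Vh : I -> set ('rV[R]_d -> 'rV[R]_d)) (Qh Wh : I -> set ('rV[R]_d -> R))
  (hVh : forall i, fe_vspace (Th i) (Vh i) /\ Vh i `<=` H10v Om)
  (hQh : forall i, fe_space (Th i) (Qh i) /\ Qh i `<=` L2 Om)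
  (hWh : forall i, fe_space (Th i) (Wh i) /\ Wh i `<=` H10 Om)
  (hQh0 : forall i xi, Qh i xi -> Qh i (mean_free Om xi))
  (gamma : R) (hgamma : 0 < gamma)
  (hinfsup : forall i,
    (gamma%:E <= infsup (fun xi v => ip Om (diverg Om v) xi)
                   (l2norm Om) (h1normv Om)
                   [set xi | (Qh i `&` L20 Om) xi /\ nonzero_ae Om xi]
                   [set v | Vh i v /\ nonzero_ae Om v])%E) :
  exists2 zeta : R, 0 < zeta &
    forall (i : I) (P : params R), admissible P ->
      palpha P ^+ 2 / plam P <= Cp P -> pbeta P ^+ 2 / plam P <= CT P ->
      (zeta%:E <= infsup (Ah Om P) (normB2 Om P) (normB2 Om P)
                    [set x | Xh (Vh i) (Qh i) (Wh i) x /\ nonzero_state Om x]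
                    [set y | Xh (Vh i) (Qh i) (Wh i) y /\ nonzero_state Om y])%E.
Proof.
have d0 : (0 < d)%N by case: hd => ->.
exists (stability_constant gamma); first exact: stability_constant_gt0.
move=> i P aP hp hT.
have feN (W : set ('rV[R]_d -> R)) f : fe_space (Th i) W -> W f -> W (fun x => - f x).
  move=> [W0 Wl _] Wf; have := Wl (-1) _ _ Wf W0.
  by under eq_fun do rewrite mulN1r addr0.
have [[feV subV] [feQ subQ] [feW subW]] := And3 (hVh i) (hQh i) (hWh i).
apply: (@infsup_stability _ _ Om (domain_open hOm) (domain_bounded hOm) d0) => //.
- exact: fe_zero feQ.
- exact: fe_zero feW.
- by move=> f; exact: feN.
- by move=> f; exact: feN.
- exact: hQh0.
Qed.
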